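(* Let $m$ be a positive integer. Then there is a positive number $c$ such that for an arbitrary nondecreasing function $\omega:(0,\infty)\to(0,\infty)$ satisfying $$\lim_{x\to0}\omega(x)=0\quad\text{and}\quad\omega(2x)\le2^m\omega(x)\ \text{ for } x>0,$$ an arbitrary bounded function $f$ in $\Lambda_{\omega,m}(\mathbb R)$, and arbitrary bounded self-adjoint operators $A$ and $K$ on Hilbert space the following inequality holds: $$\left\|\sum_{j=0}^m(-1)^{m-j}\binom mj f\big(A+jK\big)\right\|\le c\,\|f\|_{\Lambda_{\omega,m}(\mathbb R)}\,\omega_{*,m}\big(\|K\|\big).$$
   Context: For $t\in\mathbb R$ put $(\Delta_tf)(x)=f(x+t)-f(x)$, $x\in\mathbb R$, and let $\Delta_t^m$ be its $m$-th power. $\Lambda_{\omega,m}(\mathbb R)$ is the space of continuous functions $f$ on $\mathbb R$ satisfying $$\|f\|_{\Lambda_{\omega,m}(\mathbb R)}=\sup_{t>0}\frac{\|\Delta_t^mf\|_{L^\infty}}{\omega(t)}<\infty .$$ For $x>0$, $$\omega_{*,m}(x)=x^m\int_x^\infty\frac{\omega(t)}{t^{m+1}}\,dt=\int_1^\infty\frac{\omega(sx)}{s^{m+1}}\,ds$$ (possibly $+\infty$), and $\omega_{*,m}(0)=0$. *)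

(* Defs.v *)
From HB Require Import structures.
From mathcomp Require Import all_boot all_order all_algebra.
From mathcomp Require Import complex.
From mathcomp Require Import all_classical all_reals all_analysis.

Set Implicit Arguments.
Unset Strict Implicit.
Unset Printing Implicit Defensive.
Import Order.TTheory GRing.Theory Num.Theory.
Import numFieldNormedType.Exports.
Local Open Scope classical_set_scope.
Local Open Scope ring_scope.
Local Open Scope complex_scope.

(* Complex Hilbert spaces. Positive definiteness of the inner product follows
   from [inner_norm], since `| | is a norm; completeness comes from the base
   structure. *)
HB.mixin Record CompleteNormedModule_isHilbert (R : realType) H
    of CompleteNormedModule R[i] H := {
  inner : H -> H -> R[i] ;
  innerDl : forall u v w : H, inner (u + v) w = inner u w + inner v w ;
  innerZl : forall (a : R[i]) (u v : H), inner (a *: u) v = a * inner u v ;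
  innerC : forall u v : H, inner v u = (inner u v)^* ;
  inner_norm : forall u : H, inner u u = `|u| ^+ 2
}.

#[short(type="hilbertType")]
HB.structure Definition Hilbert (R : realType) :=
  { H of CompleteNormedModule_isHilbert R H & CompleteNormedModule R[i] H }.

Section operators.
Context {R : realType} {H : hilbertType R}.
Implicit Types (A B : H -> H) (f : R -> R[i]^o) (p : {poly R[i]}).

(* The norm of H takes values in R[i], in the nonnegative reals. *)
Definition opnorm A : \bar R :=
  ereal_sup [set (complex.Re `|A v|)%:E | v in [set v : H | `|v| <= 1]].

Definition bounded_op A := (opnorm A < +oo)%E.

Definition selfadjoint A := forall u v : H, inner (A u) v = inner u (A v).

Definition spectrum A : set R[i] :=
  [set z | ~ exists B : {linear H -> H}, [/\ bounded_op B,
     forall v, B (A v - z *: v) = v & forall v, A (B v) - z *: B v = v]].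

Definition poly_op p A : H -> H :=
  fun v => \sum_(i < size p) p`_i *: iter i A v.

(* The continuous functional calculus: f(A) is the norm limit of p_n(A), for
   polynomials p_n converging to f uniformly on the spectrum of A. Only real
   points of the spectrum are used, as it is real when A is self-adjoint. The
   linear map L is required because [opnorm] sees only the unit ball. *)
Definition is_cfc A f B :=
  (exists L : {linear H -> H}, B = L) /\
  exists p : nat -> {poly R[i]},
    {uniform [set x : R | spectrum A x%:C],
       (fun n (x : R) => (p n).[x%:C] : R[i]^o) @ \oo --> f} /\
    opnorm (poly_op (p n) A \- B) @[n --> \oo] --> 0%E.

(* For A bounded self-adjoint and f continuous, there is exactly one such B, so
   the default value is not used. *)
Definition cfc A f : H -> H := xget (fun=> 0) [set B | is_cfc A f B].

End operators.

Section zygmund.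
Context {R : realType}.
Implicit Types (f : R -> R[i]^o) (omega : R -> R).

Definition fdiff (t : R) f : R -> R[i]^o := fun x => f (x + t) - f x.

Definition Linfty_norm f : \bar R :=
  Lnorm (@lebesgue_measure R) +oo%E (fun x => (complex.Re `|f x|)%:E).

Definition Lambda_norm omega (m : nat) f : \bar R :=
  ereal_sup [set (Linfty_norm (iter m (fdiff t) f) * ((omega t)^-1)%:E)%E
            | t in [set t : R | 0 < t]].

Definition Lambda omega (m : nat) : set (R -> R[i]^o) :=
  [set f | continuous f /\ (Lambda_norm omega m f < +oo)%E].

Definition omega_star omega (m : nat) (x : R) : \bar R :=
  if x == 0 then 0%E
  else ((x ^+ m)%:E *
    \int[lebesgue_measure]_(t in `[x, +oo[) (omega t / t ^+ m.+1)%:E)%E.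

End zygmund.

(* Main.v *)
(* Let k be the norm of K and s_n = 2^n k.  For a bounded h the
   convolution G of h with the kernel phi (x / s), phi (t) = (1 + t^2)^-(m+1), is
   a superposition of products of resolvents of x.  The m-th difference of
   j |-> G (A + j K) is then a superposition of words containing m factors K and
   resolvents of the A + j K; Cauchy-Schwarz applied to the two outer resolvents
   and the uniform bound for sum_y |R_y u|^2 show that its norm is at most
   C (k / s)^m sup |h|.

   If T_n denotes the average of h - (-1)^m Delta_t^m h over t with density
   phi (t / s_n), then f - T_n f is O(omega (s_n)), the T_n commute, and
     f = (f - T_0 f) + sum_(n < N) (T_n (f - T_(n+1) f) - T_(n+1) (f - T_n f)) + T_N f.
   The n-th term contributes O(2^(-n m) omega (s_n)), the last one O(2^(-N m)), and
   sum_n 2^(-n m) omega (s_n) = O(omega_star k).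

   All averages are finite sums over an arithmetic progression, so that no
   operator-valued integral is needed; f is compared with its smooth model at
   lattice points only, and uniform continuity takes care of the other points. *)
Require Import Defs.
From HB Require Import structures.
From mathcomp Require Import all_boot all_order all_algebra.
From mathcomp Require Import complex ring lra zify.
From mathcomp Require Import all_classical all_reals all_analysis.
From mathcomp Require Import ess_sup_inf measurable_realfun.

Set Implicit Arguments.
Unset Strict Implicit.
Unset Printing Implicit Defensive.
Import Order.TTheory GRing.Theory Num.Theory.
Import numFieldNormedType.Exports.
Local Open Scope classical_set_scope.
Local Open Scope ring_scope.
Local Open Scope complex_scope.

(** * Real-valued norms and inner products *)

(** At the scale of [K] the smoothed function [T_0 f] is controlled only by sup |f|, which the
    seminorm does not see. In the telescoping sum each smoothing operator acts instead on a
    difference f - T f at a neighbouring scale, of size O(omega); sup |f| survives only in T_N f,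
    where the factor 2^(-N m) removes it as N grows.

    The convolution estimate plays the part of Bernstein's inequality for functions of exponential
    type. A rational kernel is chosen because its functional calculus consists of resolvents, whose
    differences in j are given exactly by the resolvent identity. The exponent m + 1 is a balance: m
    factors of the kernel absorb the growth omega (t s) = O((1 + t)^m omega (s)), and the last one
    keeps the lattice sums bounded.

    Averaging h - (-1)^m Delta_t^m h rather than h makes f - T f an average of m-th differences,
    while T h contains only the values h (x + j t) with j >= 1; it is thus a combination of m
    convolutions, with kernels of widths j s. *)

Section real_norm.
Context {R : realType}.

Definition nrm {V : normedZmodType R[i]} (v : V) : R := complex.Re `|v|.

Section zmod.
Context {V : normedZmodType R[i]}.
Implicit Types u v : V.

Lemma normE v : `|v| = (nrm v)%:C.
Proof.
by rewrite /nrm; have := normr_ge0 v; case: `|v| => a b /=; rewrite lecE /= => /andP[/eqP -> _].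
Qed.

Lemma nrm_ge0 v : 0 <= nrm v.
Proof. by rewrite -lecR -normE normr_ge0. Qed.

Lemma nrm0 : nrm (0 : V) = 0.
Proof. by rewrite /nrm normr0. Qed.

Lemma nrm_eq0 v : (nrm v == 0) = (v == 0).
Proof. by rewrite -[RHS]normr_eq0 normE -(inj_eq (@complexI R)). Qed.

Lemma nrmN v : nrm (- v) = nrm v.
Proof. by rewrite /nrm normrN. Qed.

Lemma nrm_distC u v : nrm (u - v) = nrm (v - u).
Proof. by rewrite /nrm distrC. Qed.

Lemma nrmD u v : nrm (u + v) <= nrm u + nrm v.
Proof. by rewrite -lecR rmorphD /= -!normE ler_normD. Qed.

Lemma nrmB u v : nrm (u - v) <= nrm u + nrm v.
Proof. by rewrite (le_trans (nrmD _ _)) // nrmN. Qed.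

Lemma nrm_sum I (r : seq I) (P : pred I) (F : I -> V) :
  nrm (\sum_(i <- r | P i) F i) <= \sum_(i <- r | P i) nrm (F i).
Proof.
elim/big_rec2: _ => [|i y x _ h]; first by rewrite nrm0.
by rewrite (le_trans (nrmD _ _)) // lerD2l.
Qed.

Lemma nrm_le v (x : R) : (`|v| <= x%:C) = (nrm v <= x).
Proof. by rewrite normE lecR. Qed.

End zmod.

Lemma nrmZ (V : normedModType R[i]) (a : R[i]) (v : V) :
  nrm (a *: v) = nrm a * nrm v.
Proof. by apply: complexI; rewrite -normE normrZ rmorphM /= -!normE. Qed.

Lemma nrmM (a b : R[i]) : nrm (a * b) = nrm a * nrm b.
Proof. by apply: complexI; rewrite -normE normrM rmorphM /= -!normE. Qed.

Lemma nrmX (a : R[i]) n : nrm (a ^+ n) = nrm a ^+ n.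
Proof. by apply: complexI; rewrite -normE normrX rmorphXn /= -!normE. Qed.

Lemma nrmV (a : R[i]) : nrm a^-1 = (nrm a)^-1.
Proof. by apply: complexI; rewrite -normE normfV fmorphV /= -!normE. Qed.

Lemma nrmR (a : R) : nrm (a%:C : R[i]) = `|a|.
Proof.
by rewrite /nrm normc_def /= expr0n /= addr0 sqrtr_sqr.
Qed.

Lemma nrm1 : nrm (1 : R[i]) = 1.
Proof. by rewrite -[1]/(1%:C) nrmR normr1. Qed.

Lemma nrm_nat n : nrm (n%:R : R[i]) = n%:R.
Proof. by rewrite -(rmorph_nat (@real_complex R)) nrmR normr_nat. Qed.

Lemma nrm_sqr (a : R[i]) : (nrm a ^+ 2)%:C = a * conjc a.
Proof. by rewrite rmorphXn /= -normE sqr_normc. Qed.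

Lemma nrm_conj (a : R[i]) : nrm (conjc a) = nrm a.
Proof. by case: a => a b; rewrite /nrm !normc_def /= sqrrN. Qed.

End real_norm.

Section hilbert.
Context {R : realType} {H : hilbertType R}.
Implicit Types u v w : H.

Lemma innerDr u v w : inner u (v + w) = inner u v + inner u w.
Proof. by rewrite innerC innerDl rmorphD /= -!innerC. Qed.

Lemma innerZr (a : R[i]) u v : inner u (a *: v) = conjc a * inner u v.
Proof. by rewrite innerC innerZl rmorphM /= -!innerC. Qed.

Lemma inner0l v : inner 0 v = 0.
Proof. by rewrite -(scale0r (0 : H)) innerZl mul0r. Qed.

Lemma inner0r v : inner v 0 = 0.
Proof. by rewrite innerC inner0l rmorph0. Qed.

Lemma innerNl u v : inner (- u) v = - inner u v.
Proof. by rewrite -scaleN1r innerZl mulN1r. Qed.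

Lemma innerNr u v : inner u (- v) = - inner u v.
Proof. by rewrite innerC innerNl rmorphN /= -innerC. Qed.

Lemma innerBl u v w : inner (u - v) w = inner u w - inner v w.
Proof. by rewrite innerDl innerNl. Qed.

Lemma innerBr u v w : inner u (v - w) = inner u v - inner u w.
Proof. by rewrite innerDr innerNr. Qed.

Lemma inner_suml I (r : seq I) (P : pred I) (F : I -> H) v :
  inner (\sum_(i <- r | P i) F i) v = \sum_(i <- r | P i) inner (F i) v.
Proof. by apply: (big_morph (fun u => inner u v)); [move=> ? ?; rewrite innerDl|rewrite inner0l]. Qed.

Lemma inner_nrm v : inner v v = (nrm v ^+ 2)%:C.
Proof. by rewrite inner_norm normE rmorphXn. Qed.

Lemma cauchy_schwarz u v : nrm (inner u v) <= nrm u * nrm v.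
Proof.
have [->|v0] := eqVneq v 0; first by rewrite inner0r !nrm0 mulr0.
have v0' : 0 < nrm v by rewrite lt_def nrm_eq0 v0 nrm_ge0.
have key : 0 <= nrm u ^+ 2 - nrm (inner u v) ^+ 2 / nrm v ^+ 2.
  set n2 := (nrm v ^+ 2)%:C.
  have n20 : n2 != 0 by rewrite -[0]/(0%:C) (inj_eq (@complexI R)) expf_neq0 // gt_eqF.
  have n2c : conjc n2 = n2 by rewrite conjc_real.
  pose a := inner u v / n2.
  have -> : nrm u ^+ 2 - nrm (inner u v) ^+ 2 / nrm v ^+ 2 = nrm (u - a *: v) ^+ 2.
    apply: complexI; rewrite -inner_nrm innerBl !innerBr !innerZl !innerZr !inner_nrm.
    rewrite rmorphB fmorph_div /= -/n2 nrm_sqr (innerC u v).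
    have -> : conjc a = conjc (inner u v) / n2.
      transitivity (conjc (inner u v) * conjc n2^-1); first exact: rmorphM.
      by rewrite conjc_inv n2c.
    rewrite /a.
    have aux (F : fieldType) (x y z n : F) : n != 0 ->
        x - y * z / n = x - z / n * y - (y / n * z - y / n * (z / n * n)).
      by move=> n0; field.
    exact: aux.
  by rewrite sqr_ge0.
move: key; rewrite subr_ge0 ler_pdivrMr ?exprn_gt0 // -exprMn.
by rewrite ler_pXn2r // ?nnegrE ?mulr_ge0 ?nrm_ge0.
Qed.

Lemma nrm_innerP (w : H) (c : R) : 0 <= c ->
  (forall v, nrm (inner w v) <= c * nrm v) -> nrm w <= c.
Proof.
move=> c0 /(_ w); rewrite inner_nrm nrmR ger0_norm ?sqr_ge0 //.
have [->|w0] := eqVneq w 0; first by rewrite nrm0.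
by rewrite expr2 ler_pM2r // lt_def nrm_eq0 w0 nrm_ge0.
Qed.

(** Since [inner (A v) v] is real, the cross terms see only the real part of z. Hence A - z is
    bounded below off the real axis. *)
Lemma selfadjoint_shift (A : {linear H -> H}) (z : R[i]) v : selfadjoint A ->
  nrm (A v - z *: v) ^+ 2 =
  nrm (A v - (complex.Re z)%:C *: v) ^+ 2 + complex.Im z ^+ 2 * nrm v ^+ 2.
Proof.
move=> sA; apply: complexI; rewrite rmorphD /= -!inner_nrm [X in _ = _ + X]rmorphM /= -inner_nrm.
have sc : conjc (inner (A v) v) = inner (A v) v by rewrite -innerC -sA.
rewrite !(innerBl, innerBr, innerZl, innerZr) -(sA v v) conjc_real.
have zD : z + conjc z = (complex.Re z)%:C *+ 2.
  by case: (z) => a b; rewrite mulr2n /=; simpc.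
have zM : z * conjc z = (complex.Re z)%:C ^+ 2 + (complex.Im z)%:C ^+ 2.
  case: (z) => a b; apply/eqP; rewrite eq_complex /=.
  by apply/andP; split; apply/eqP; ring.
rewrite rmorphXn /=.
transitivity (inner (A v) (A v) - (z + conjc z) * inner (A v) v + z * conjc z * inner v v).
  by ring.
by rewrite zD zM; ring.
Qed.

Lemma selfadjoint_shift_ge (A : {linear H -> H}) (z : R[i]) v : selfadjoint A ->
  `|complex.Im z| * nrm v <= nrm (A v - z *: v).
Proof.
move=> sA; rewrite -(ler_pXn2r (n := 2)) // ?nnegrE ?mulr_ge0 ?nrm_ge0 //.
by rewrite selfadjoint_shift // exprMn real_normK ?num_real // lerDr sqr_ge0.
Qed.

End hilbert.

(** * Bounded operators *)

Section bounded_operators.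
Context {R : realType} {H : hilbertType R}.
Implicit Types (T : {linear H -> H}) (u v w : H).

(** Quantifying over all vectors keeps the bound meaningful for maps not known to be linear and
    avoids extended reals. *)
Definition op_le (T : H -> H) (c : R) := forall v, nrm (T v) <= c * nrm v.

Definition lin_fun (f : H -> H) (lf : linear f) := f.
HB.instance Definition _ f (lf : linear f) :=
  GRing.isLinear.Build R[i] H H _ (@lin_fun f lf) lf.

Lemma opnorm_le T (c : R) : 0 <= c -> (opnorm T <= c%:E)%E <-> op_le T c.
Proof.
move=> c0; split=> [h v|h]; last first.
  apply: ub_ereal_sup => _ [v /= v1 <-]; rewrite lee_fin.
  rewrite (le_trans (h v)) // ler_piMr // -nrm_le.
  by rewrite -[_%:C]/(1 : R[i]).
have [->|v0] := eqVneq v 0; first by rewrite linear0 !nrm0 mulr0.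
have v0' : 0 < nrm v by rewrite lt_def nrm_eq0 v0 nrm_ge0.
pose u := ((nrm v)^-1)%:C *: v.
have nu : nrm u = 1 by rewrite nrmZ nrmR gtr0_norm ?invr_gt0 // mulVf ?gt_eqF.
have : ((nrm (T u))%:E <= c%:E)%E.
  apply: le_trans h; apply: ereal_sup_ubound; exists u => //=.
  by rewrite -[1]/(1%:C) nrm_le nu.
by rewrite lee_fin linearZ /= nrmZ nrmR gtr0_norm ?invr_gt0 // ler_pdivrMl // mulrC.
Qed.

Lemma opnorm_ge0 T : (0 <= opnorm T)%E.
Proof.
apply: ereal_sup_ubound; exists 0; first by rewrite /= normr0 ler01.
by rewrite linear0 normr0.
Qed.

Lemma bounded_op_fin_num T : bounded_op T -> opnorm T = (fine (opnorm T))%:E.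
Proof. by move=> bT; rewrite fineK // ge0_fin_numE // opnorm_ge0. Qed.

Lemma fine_opnorm_ge0 T : 0 <= fine (opnorm T).
Proof. by rewrite fine_ge0 // opnorm_ge0. Qed.

Lemma bounded_opP T : bounded_op T -> op_le T (fine (opnorm T)).
Proof.
by move=> bT; apply/opnorm_le; rewrite ?fine_opnorm_ge0 // -bounded_op_fin_num.
Qed.

Lemma op_le_bounded T (c : R) : 0 <= c -> op_le T c -> bounded_op T.
Proof. by move=> c0 /opnorm_le => /(_ c0) h; rewrite /bounded_op (le_lt_trans h) ?ltry. Qed.

Lemma opnorm_cvg0 (T : nat -> H -> H) : (forall n, linear (T n)) ->
  opnorm (T n) @[n --> \oo] --> 0%E <->
  forall e : R, 0 < e -> exists N, forall n, (N <= n)%N -> op_le (T n) e.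
Proof.
move=> lT.
have T' n : exists L : {linear H -> H}, T n = L.
  by exists (lin_fun (lT n)).
split=> [/fine_cvgP[h1 /cvgrPdist_lt h2] e e0|h].
  have [N _ hN] := filterI h1 (h2 _ e0).
  exists N => n /hN [/= fn]; rewrite sub0r normrN => lt.
  have [L eL] := T' n; rewrite eL; apply/opnorm_le; first exact: ltW.
  rewrite -eL -(fineK fn) lee_fin (le_trans _ (ltW lt)) // ler_norm //.
have ev e : 0 < e -> exists N, forall n, (N <= n)%N -> (opnorm (T n) <= e%:E)%E.
  move=> e0; have [N hN] := h _ e0; exists N => n /hN.
  by have [L ->] := T' n; move=> /(opnorm_le _ (ltW e0)).
have ge0 n : (0 <= opnorm (T n))%E by have [L ->] := T' n; rewrite opnorm_ge0.
have finT e n : (opnorm (T n) <= e%:E)%E -> opnorm (T n) \is a fin_num.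
  by move=> le; rewrite ge0_fin_numE // (le_lt_trans le) // ltry.
apply/fine_cvgP; split.
  by have [N hN] := ev 1 ltr01; exists N => // n /hN /finT.
apply/cvgrPdist_le => e e0; have [N hN] := ev _ e0; exists N => // n /= /hN le.
rewrite sub0r normrN ger0_norm ?fine_ge0 // -lee_fin fineK //; exact: finT le.
Qed.

(** Completeness of H gives the limit on each vector; the Cauchy estimate is uniform on vectors of
    bounded norm and survives the limit in k. *)
Lemma op_cauchy_lim (T : nat -> {linear H -> H}) :
  (forall e : R, 0 < e -> exists N, forall n k, (N <= n)%N -> (N <= k)%N ->
     op_le (T n \- T k) e) ->
  exists B : {linear H -> H}, forall e : R, 0 < e ->
    exists N, forall n, (N <= n)%N -> op_le (T n \- B) e.
Proof.
move=> hT.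
have cv v : cvgn (fun n => T n v).
  apply/cauchy_cvgP/cauchyP => e e0.
  have e0' : 0 < complex.Re e / (nrm v + 1).
    rewrite divr_gt0 ?ltr_wpDl ?nrm_ge0 //.
    by move: e0; rewrite ltcE => /andP[].
  have [N hN] := hT _ e0'.
  exists (T N v); exists N => // k kN; rewrite /= -ball_normE /=.
  have eE : e = (complex.Re e)%:C.
    by case: (e) e0 => a b; rewrite ltcE /= => /andP[/eqP ->].
  rewrite [X in _ < X]eE normE ltcR; have := hN N k (leqnn N) kN v => /= h.
  rewrite (le_lt_trans h) // -mulrA gtr_pMr; last by rewrite -ltcR -eE.
  by rewrite mulrC ltr_pdivrMr ?ltr_wpDl ?nrm_ge0 // mul1r ltrDl.
pose B v := limn (fun n => T n v).
have lB : linear B.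
  move=> a u v; apply/cvg_lim => //.
  under eq_fun do rewrite linearP.
  apply: cvgD; last exact: cv.
  by apply: cvgZr; exact: cv.
exists (lin_fun lB) => e e0; have [N hN] := hT _ e0; exists N => n nN v /=.
apply/ler_addgt0Pr => d d0.
have := cv v; move/cvgrPdist_lt => /(_ d%:C); rewrite ltcR => /(_ d0) [M _ hM].
have := hM (maxn M N) (leq_maxl _ _) => /=.
rewrite normE ltcR => h1; have := hN n (maxn M N) nN (leq_maxr _ _) v => /= h2.
rewrite -(subrK (T (maxn M N) v) (T n v)) -addrA (le_trans (nrmD _ _)) //.
by rewrite lerD // nrm_distC ltW.
Qed.

End bounded_operators.

Section uniform.
Context {R : realType}.

Lemma uniform_cvgP (S : set R) (p : nat -> R -> R[i]^o) (f : R -> R[i]^o) :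
  {uniform S, p @ \oo --> f} <->
  forall e : R, 0 < e -> exists N, forall n, (N <= n)%N ->
    forall x, S x -> nrm (f x - p n x) <= e.
Proof.
split=> [h e e0|h].
  have e0' : (0 : R[i]) < e%:C by rewrite ltcR.
  have [|N _ hN] := h [set g | forall x, S x -> ball (f x) e%:C (g x)].
    apply/uniform_nbhs; exists [set xy | ball xy.1 e%:C xy.2]; split => //.
    exact: entourage_ball (PosNum e0').
  exists N => n nN x Sx; rewrite -nrm_le ltW //.
  by have := hN n nN x Sx; rewrite -ball_normE.
move=> P /uniform_nbhs [E [entE EP]].
have [e /= e0 eE] : exists2 e : R[i], 0 < e & [set xy : R[i]^o * R[i]^o | ball xy.1 e xy.2] `<=` E.
  by move: entE; rewrite -entourage_ballE => -[e e0 he]; exists e.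
have eE' : e = (complex.Re e)%:C.
  by case: e e0 {eE} => a b; rewrite ltcE /= => /andP[/eqP ->].
have [|N hN] := h (complex.Re e / 2).
  by rewrite divr_gt0 // -ltcR -eE'.
exists N => // n /= nN; apply: EP => y Sy; apply: eE; rewrite /= -ball_normE /=.
rewrite [X in _ < X]eE' normE ltcR (le_lt_trans (hN n nN y Sy)) //.
by rewrite ltr_pdivrMr // ltr_pMr ?ltr1n // -ltcR -eE'.
Qed.

End uniform.

(** * Polynomials of a self-adjoint operator *)

Section polynomial_calculus.
Context {R : realType} {H : hilbertType R}.
Implicit Types (A : {linear H -> H}) (p q : {poly R[i]}) (u v w : H).

Lemma poly_opE n p A v : (size p <= n)%N ->
  poly_op p A v = \sum_(i < n) p`_i *: iter i A v.
Proof.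
move=> pn; rewrite /poly_op (big_ord_widen n (fun i => p`_i *: iter i A v)) //.
rewrite big_mkcond; apply: eq_bigr => i _; case: ifPn => //.
by rewrite -leqNgt => /leq_sizeP/(_ _ (leqnn _)) ->; rewrite scale0r.
Qed.

Lemma poly_opD p q A v : poly_op (p + q) A v = poly_op p A v + poly_op q A v.
Proof.
have sz := size_polyD p q.
rewrite (poly_opE _ _ sz) (@poly_opE (maxn (size p) (size q)) p) ?leq_maxl //.
rewrite (@poly_opE (maxn (size p) (size q)) q) ?leq_maxr // -big_split /=.
by apply: eq_bigr => i _; rewrite coefD scalerDl.
Qed.

Lemma poly_opZ (a : R[i]) p A v : poly_op (a *: p) A v = a *: poly_op p A v.
Proof.
rewrite (poly_opE _ _ (size_scale_leq a p)) /poly_op scaler_sumr.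
by apply: eq_bigr => i _; rewrite coefZ scalerA.
Qed.

Lemma poly_opN p A v : poly_op (- p) A v = - poly_op p A v.
Proof. by rewrite -scaleN1r poly_opZ scaleN1r. Qed.

Lemma poly_opB p q A v : poly_op (p - q) A v = poly_op p A v - poly_op q A v.
Proof. by rewrite poly_opD poly_opN. Qed.

Lemma poly_opC (c : R[i]) A v : poly_op c%:P A v = c *: v.
Proof. by rewrite (poly_opE _ _ (size_polyC_leq1 c)) big_ord1 coefC. Qed.

Lemma poly_op_linear p A : linear (poly_op p A).
Proof.
move=> a u v; rewrite /poly_op scaler_sumr -big_split; apply: eq_bigr => i _ /=.
have -> : iter i A (a *: u + v) = a *: iter i A u + iter i A v.
  by elim: (i : nat) => //= n ->; rewrite linearP.
by rewrite scalerDr !scalerA mulrC.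
Qed.

Definition pop p A : {linear H -> H} := lin_fun (poly_op_linear p A).

Lemma poly_opMX p A v : poly_op (p * 'X) A v = A (poly_op p A v).
Proof.
have sz : (size (p * 'X)%R <= (size p).+1)%N.
  by rewrite (leq_trans (size_polyMleq _ _)) // size_polyX addn2.
rewrite (poly_opE _ _ sz) big_ord_recl coefMX eqxx scale0r add0r.
rewrite /poly_op linear_sum; apply: eq_bigr => i _.
by rewrite coefMX /= linearZ.
Qed.

Lemma poly_opX A v : poly_op 'X A v = A v.
Proof. by rewrite -['X]mul1r poly_opMX -polyC1 poly_opC scale1r. Qed.

Lemma poly_opM p q A v : poly_op (p * q) A v = poly_op p A (poly_op q A v).
Proof.
elim/poly_ind: p => [|p c IH].
  by rewrite mul0r -polyC0 !poly_opC !scale0r.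
rewrite mulrDl mulrAC !poly_opD !poly_opMX IH.
by rewrite mul_polyC poly_opZ poly_opC.
Qed.

Lemma poly_op_adj p A u v : selfadjoint A ->
  inner (poly_op p A u) v = inner u (poly_op (map_poly (@conjc R) p) A v).
Proof.
move=> sA; elim/poly_ind: p u v => [|p c IH] u v.
  by rewrite rmorph0 -polyC0 !poly_opC !scale0r inner0l inner0r.
rewrite rmorphD rmorphM /= map_polyX map_polyC /= !poly_opD !poly_opMX !poly_opC.
rewrite innerDl innerDr innerZl innerZr conjcK sA IH; congr (inner _ _ + _).
by rewrite -{1}(poly_opX A v) -poly_opM poly_opMX.
Qed.

Lemma poly_op_bounded p A : bounded_op A -> bounded_op (pop p A).
Proof.
move=> bA; set a := fine (opnorm A).
have a0 : 0 <= a by exact: fine_opnorm_ge0.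
apply: (@op_le_bounded _ _ _ (\sum_(i < size p) nrm p`_i * a ^+ i)).
  by apply: sumr_ge0 => i _; rewrite mulr_ge0 ?nrm_ge0 ?exprn_ge0.
move=> v; rewrite /= /lin_fun /poly_op (le_trans (nrm_sum _ _ _)) //.
rewrite mulr_suml; apply: ler_sum => i _; rewrite nrmZ -mulrA ler_wpM2l ?nrm_ge0 //.
elim: (i : nat) => [|n IH] /=; first by rewrite mul1r.
rewrite (le_trans (bounded_opP bA _)) // exprS -mulrA ler_wpM2l //.
Qed.

Definition bounded_below (T : H -> H) := exists2 c : R, 0 < c & forall v, c * nrm v <= nrm (T v).

(** Off the real axis the imaginary part gives the bound; at a real point outside the spectrum the
    bounded inverse does. *)
Lemma bounded_below_shift A z : selfadjoint A ->
  ~ (complex.Im z = 0 /\ spectrum A z) -> bounded_below (fun v => A v - z *: v).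
Proof.
move=> sA h; have [z0|z0] := eqVneq (complex.Im z) 0; last first.
  by exists `|complex.Im z|; [rewrite normr_gt0|move=> v; exact: selfadjoint_shift_ge].
have : ~ spectrum A z by move=> sz; exact: h.
move=> /contrapT[B [bB BA _]].
have b0 := fine_opnorm_ge0 B; have b1 : 0 < fine (opnorm B) + 1 by rewrite ltr_wpDl.
exists (fine (opnorm B) + 1)^-1; first by rewrite invr_gt0.
move=> v; rewrite ler_pdivrMl // -{1}(BA v) (le_trans (bounded_opP bB _)) //.
by rewrite ler_wpM2r ?nrm_ge0 // lerDl.
Qed.

Lemma bounded_below_poly A (r : seq R[i]) :
  (forall z, z \in r -> bounded_below (fun v => A v - z *: v)) ->
  bounded_below (poly_op (\prod_(z <- r) ('X - z%:P)) A).
Proof.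
elim: r => [_|z r IH h].
  by exists 1 => // v; rewrite big_nil -polyC1 poly_opC scale1r mul1r.
have [|c c0 hc] := IH; first by move=> y yr; apply: h; rewrite inE yr orbT.
have [d d0 hd] := h z (mem_head _ _).
exists (d * c); first exact: mulr_gt0.
move=> v; rewrite big_cons poly_opM poly_opB poly_opX poly_opC.
by rewrite -mulrA (le_trans _ (hd _)) // ler_wpM2l // ltW.
Qed.

Lemma horner_normsq p (x : R) :
  (map_poly (@conjc R) p * p).[x%:C] = (nrm p.[x%:C] ^+ 2)%:C.
Proof.
by rewrite hornerM -{1}(conjc_real x) horner_map /= nrm_sqr mulrC.
Qed.

(* If s = ||p(A)|| > M, then conj(p) p - s^2 splits into factors X - z with A - z
   bounded below, so that s^2 ||v||^2 - ||p(A) v||^2 >= c ||v||^2 with c > 0, against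
   the definition of s; this replaces the spectral mapping theorem. *)
Lemma poly_op_le_aux A p (M : R) : bounded_op A -> selfadjoint A -> 0 <= M ->
  (forall x : R, spectrum A x%:C -> nrm p.[x%:C] <= M) ->
  map_poly (@conjc R) p * p != ((fine (opnorm (pop p A)) ^+ 2)%:C)%:P ->
  op_le (poly_op p A) M.
Proof.
move=> bA sA M0 hM; set s := fine _; set q := map_poly _ p * p; move=> qs.
have s0 : 0 <= s by exact: fine_opnorm_ge0.
have Ss : op_le (pop p A) s by apply/bounded_opP/poly_op_bounded.
have [sM|Ms] := leP s M.
  by move=> v; rewrite (le_trans (Ss v)) // ler_wpM2r ?nrm_ge0.
have sgt0 : 0 < s by exact: le_lt_trans Ms.
set l := s ^+ 2; pose S := pop p A; pose T := pop q A.
have [r qr] := closed_field_poly_normal (q - (l%:C)%:P).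
have [c c0 hc] : bounded_below (pop (q - (l%:C)%:P) A).
  have [|c c0 hc] := @bounded_below_poly A r.
    move=> z zr; apply: bounded_below_shift => // -[z0 sz].
    have rz : root (q - (l%:C)%:P) z.
      by rewrite qr rootZ ?root_prod_XsubC // lead_coef_eq0 subr_eq0.
    have zE : z = (complex.Re z)%:C by case: (z) z0 => a b /= ->.
    move: rz; rewrite rootE hornerD hornerN hornerC zE horner_normsq subr_eq0.
    rewrite (inj_eq (@complexI R)) => /eqP e.
    have : nrm p.[(complex.Re z)%:C] <= M by apply: hM; rewrite -zE.
    rewrite -(ler_pXn2r (n := 2)) ?nnegrE ?nrm_ge0 // e.
    by rewrite leNgt ltr_pXn2r ?nnegrE // Ms.
  have lc0 : lead_coef (q - (l%:C)%:P) != 0 by rewrite lead_coef_eq0 subr_eq0.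
  exists (nrm (lead_coef (q - (l%:C)%:P)) * c).
    by rewrite mulr_gt0 // lt_def nrm_eq0 lc0 nrm_ge0.
  move=> v; have -> : pop (q - (l%:C)%:P) A v =
      lead_coef (q - (l%:C)%:P) *: poly_op (\prod_(z <- r) ('X - z%:P)) A v.
    by rewrite -poly_opZ -qr.
  rewrite nrmZ -mulrA ler_wpM2l ?nrm_ge0 //.
(* The conjugate polynomial gives the adjoint of S, so duality transfers the bound s to it. *)
have Sadj w : nrm (pop (map_poly (@conjc R) p) A w) <= s * nrm w.
  apply: nrm_innerP; first by rewrite mulr_ge0 ?nrm_ge0.
  move=> v; rewrite innerC nrm_conj -poly_op_adj // (le_trans (cauchy_schwarz _ _)) //.
  by rewrite mulrAC ler_wpM2r ?nrm_ge0 //; exact: Ss.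
have TE v : pop q A v = pop (map_poly (@conjc R) p) A (S v) by exact: poly_opM.
(* With T = S* S, expand ||(T - l) v||^2 = ||T v||^2 - 2 l ||S v||^2 + l^2 ||v||^2 and use ||T v||^2
   <= l ||S v||^2. *)
have key v : c ^+ 2 * nrm v ^+ 2 <= l ^+ 2 * nrm v ^+ 2 - l * nrm (S v) ^+ 2.
  have h1 : (c * nrm v) ^+ 2 <= nrm (T v - l%:C *: v) ^+ 2.
    rewrite ler_pXn2r ?nnegrE ?nrm_ge0 ?mulr_ge0 ?(ltW c0) ?nrm_ge0 //.
    by rewrite (le_trans (hc v)) //= /lin_fun poly_opB poly_opC.
  rewrite -exprMn (le_trans h1) //.
  have tv : inner (T v) v = (nrm (S v) ^+ 2)%:C.
    rewrite -inner_nrm innerC TE /= /lin_fun -poly_op_adj //.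
    by rewrite inner_nrm conjc_real.
  have -> : nrm (T v - l%:C *: v) ^+ 2 =
     nrm (T v) ^+ 2 - 2 * l * nrm (S v) ^+ 2 + l ^+ 2 * nrm v ^+ 2.
    apply: complexI.
    rewrite -inner_nrm !(innerBl, innerBr, innerZl, innerZr) (innerC (T v) v) tv.
    rewrite !inner_nrm !conjc_real; set a := nrm _; set b := nrm _; set d := nrm _.
    rewrite -!(rmorphM, rmorphB, rmorphD) /=; congr (_%:C); ring.
  have h2 : nrm (T v) ^+ 2 <= l * nrm (S v) ^+ 2.
    rewrite /l -exprMn ler_pXn2r ?nnegrE ?mulr_ge0 ?nrm_ge0 //.
    by rewrite TE; exact: Sadj.
  by lra.
have l0 : 0 < l by rewrite exprn_gt0.
pose s' := Num.sqrt (l - c ^+ 2 / l).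
have hs' v : nrm (S v) ^+ 2 <= (l - c ^+ 2 / l) * nrm v ^+ 2.
  rewrite -(ler_pM2l l0).
  have -> : l * ((l - c ^+ 2 / l) * nrm v ^+ 2) = l ^+ 2 * nrm v ^+ 2 - c ^+ 2 * nrm v ^+ 2.
    by field; rewrite gt_eqF.
  by have := key v; lra.
have Ss' : op_le S s'.
  move=> v; rewrite -(ler_pXn2r (n := 2)) ?nnegrE ?mulr_ge0 ?nrm_ge0 ?sqrtr_ge0 //.
  (* A negative radicand is not excluded at this point; the right side of [hs'] is then nonpositive,
     which is stronger than needed. *)
  rewrite exprMn; have [h|h] := leP 0 (l - c ^+ 2 / l).
    by rewrite sqr_sqrtr.
  rewrite (le_trans (hs' v)) // ler_wpM2r ?sqr_ge0 // (le_trans (ltW h)) ?sqr_ge0 //.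
have : s <= s'.
  rewrite -lee_fin -bounded_op_fin_num; last exact: poly_op_bounded.
  by apply/opnorm_le => //; exact: sqrtr_ge0.
rewrite leNgt => /negP[]; rewrite -(gtr0_norm sgt0) -sqrtr_sqr ltr_sqrt //.
by rewrite ltrBlDr ltrDl divr_gt0 // exprn_gt0.
Qed.

(** What remains is the case where conj(p) p is the constant s^2. Evaluating it at any real spectral
    point x gives |p(x)| = s, so s <= M, provided that such a point exists. *)
Lemma poly_op_le A p (M : R) : bounded_op A -> selfadjoint A -> 0 <= M ->
  (forall x : R, spectrum A x%:C -> nrm p.[x%:C] <= M) -> op_le (poly_op p A) M.
Proof.
move=> bA sA M0 hM.
have [[x sx]|ne] := pselect (exists x : R, spectrum A x%:C).
  set s := fine (opnorm (pop p A)).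
  have [sM|Ms] := leP s M.
    move=> v; rewrite (le_trans (bounded_opP (poly_op_bounded p bA) v)) //.
    by rewrite ler_wpM2r ?nrm_ge0.
  apply: poly_op_le_aux => //; apply/eqP => e.
  have := horner_normsq p x; rewrite e hornerC => /complexI e2.
  have := hM x sx; rewrite leNgt => /negP[].
  by rewrite -(ltr_pXn2r (n := 2)) ?nnegrE ?nrm_ge0 ?fine_opnorm_ge0 // -e2 ltr_pXn2r ?nnegrE ?fine_opnorm_ge0.
(* Empty real spectrum: the polynomial X satisfies the bound 0 vacuously and X^2 is not constant,
   hence A = 0. As 0 is outside the spectrum, the zero map is invertible and H is trivial. *)
have A0 v : A v = 0.
  apply/eqP; rewrite -nrm_eq0 eq_le nrm_ge0 andbT.
  rewrite -(mul0r (nrm v)) -poly_opX; move: v.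
  have := @poly_op_le_aux A 'X 0 bA sA (lexx _); apply.
  - by move=> x sx; case: ne; exists x.
  - apply/eqP => /(congr1 (size \o polyseq)) /=.
    rewrite map_polyX -expr2 size_polyXn => e.
    by have := size_polyC_leq1 ((fine (opnorm (pop 'X A)) ^+ 2)%:C); rewrite -e.
have V0 v : v = 0.
  have : ~ spectrum A (0%:C) by move=> s0; apply: ne; exists 0.
  move=> /contrapT[B [_ /(_ v) <- _]].
  by rewrite A0 scale0r subrr linear0.
by move=> v; rewrite (V0 (poly_op _ _ _)) nrm0 mulr_ge0 ?nrm_ge0.
Qed.

End polynomial_calculus.

(** * Weierstrass approximation *)

Section weierstrass.
Context {R : realType}.
Implicit Types (f : R -> R[i]^o).

Lemma continuous_nrm f : continuous f <->
  forall (x e : R), 0 < e -> exists2 d : R, 0 < d & forall y, `|x - y| < d -> nrm (f x - f y) < e.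
Proof.
split=> [cf x e e0|h x].
  have /cvgrPdist_lt/(_ e%:C) := cf x; rewrite ltcR => /(_ e0) [d /= d0 hd].
  exists d => // y xy; have := hd y; rewrite /ball_ /= => /(_ xy).
  by rewrite normE ltcR.
apply/cvgrPdist_lt => e e0.
have eE : e = (complex.Re e)%:C.
  by case: (e) e0 => a b; rewrite ltcE /= => /andP[/eqP ->].
have [|d d0 hd] := h x (complex.Re e); first by rewrite -ltcR -eE.
by exists d => // y /= xy; rewrite [X in _ < X]eE normE ltcR; exact: hd.
Qed.

(** Only x is confined to the segment, so that y may be a nearby lattice point outside it.
    Compactness is used in its near-covering form. *)
Lemma segment_uniform_continuous f (r : R) : continuous f ->
  forall e : R, 0 < e -> exists2 d : R, 0 < d & forall x y, `|x| <= r -> `|x - y| < d ->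
    nrm (f x - f y) <= e.
Proof.
move=> /continuous_nrm cf e e0.
have /compact_near_coveringP/near_covering_withinP cov := @segment_compact R (- r) r.
have := cov R (0^'+) (fun d x => forall y, `|x - y| < d -> nrm (f x - f y) <= e).
case.
  move=> x _; have [d d0 hd] := cf x (e / 2) (divr_gt0 e0 (ltr0n _ 2)).
  exists ([set y | `|x - y| < d / 2], [set d' | 0 < d' < d / 2]) => /=.
    split; first by exists (d / 2) => //=; exact: divr_gt0.
    exists (d / 2); first by rewrite /= divr_gt0.
    move=> d'; rewrite /ball /= sub0r normrN => h h0.
    by rewrite h0 (le_lt_trans (ler_norm _)).
  move=> [y d'] /= [xy /andP[d'0 d'd]] _ z yz.
  have h1 := hd y; have h2 := hd z.
  rewrite -(subrK (f x) (f y)) -addrA (le_trans (nrmD _ _)) //.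
  rewrite (splitr e) lerD //.
    by rewrite nrm_distC ltW // h1 // (lt_le_trans xy) // ler_pdivrMr // ler_pMr // ler1n.
  rewrite ltW // h2 // -(subrK y x) -addrA (le_lt_trans (ler_normD _ _)) //.
  by rewrite (splitr d) ltrD // (lt_trans yz).
move=> d /= d0 hd; exists (d / 2); first exact: divr_gt0.
move=> x y xr xy.
have d20 : 0 < d / 2 by exact: divr_gt0.
apply: (hd (d / 2)) => //.
  by rewrite /ball /= sub0r normrN gtr0_norm // ltr_pdivrMr // ltr_pMr // ltr1n.
by rewrite /= in_itv /= -ler_norml.
Qed.

Lemma segment_bounded f (r : R) : continuous f ->
  exists2 M : R, 0 <= M & forall x, `|x| <= r -> nrm (f x) <= M.
Proof.
move=> /continuous_nrm cf.
have /compact_near_coveringP cov := @segment_compact R (- r) r.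
have := cov nat \oo (fun n x => nrm (f x) <= n%:R).
case.
  move=> x _; have [d d0 hd] := cf x 1 ltr01.
  have [N hN] : exists N, nrm (f x) + 1 <= N%:R.
    by exists (Num.truncn (nrm (f x) + 1)).+1; rewrite ltW // truncnS_gt.
  exists ([set y | `|x - y| < d], [set n | (N <= n)%N]) => /=.
    by split; [exists d|exists N].
  move=> [y n] /= [xy Nn].
  rewrite (le_trans _ (le_trans hN _)) ?ler_nat //.
  rewrite -(subrK (f x) (f y)) addrC (le_trans (nrmD _ _)) // lerD2l nrm_distC.
  by rewrite ltW // hd.
move=> N _ hN; exists N%:R => // x xr; apply: (hN N) => /=; first exact: leqnn.
by rewrite in_itv /= -ler_norml.
Qed.

(* Bernstein operator, through the recursion obtained by conditioning on the
   last coin toss *)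
Fixpoint bern (n : nat) (t : R) (g : nat -> R) : R :=
  if n is n'.+1 then t * bern n' t (fun k => g k.+1) + (1 - t) * bern n' t g
  else g 0.

(** The recursion of [bern] with a polynomial l as success probability: its value at x is the
    Bernstein mean for the probability l(x). *)
Fixpoint bern_poly (n : nat) (l : {poly R[i]}) (g : nat -> R[i]) : {poly R[i]} :=
  if n is n'.+1 then
    l * bern_poly n' l (fun k => g k.+1) + (1 - l) * bern_poly n' l g
  else (g 0)%:P.

Lemma le_bern n t (g h : nat -> R) : 0 <= t <= 1 ->
  (forall k, (k <= n)%N -> g k <= h k) -> bern n t g <= bern n t h.
Proof.
move=> /andP[t0 t1]; elim: n g h => [|n IH] g h gh /=; first exact: gh.
by rewrite lerD // ler_wpM2l ?subr_ge0 // IH // => k kn; apply: gh => //; exact: leqW.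
Qed.

Lemma bern_affine n t (a b : R) (g : nat -> R) :
  bern n t (fun k => a + b * g k) = a + b * bern n t g.
Proof. by elim: n g => //= n IH g; rewrite !IH; ring. Qed.

(** The shift c is what makes the induction close, since a toss moves the centre by t - 1 or t. The
    case c = 0 is the variance of the binomial law. *)
Lemma bern_variance n t (c : R) :
  bern n t (fun k => (k%:R - n%:R * t - c) ^+ 2) = n%:R * t * (1 - t) + c ^+ 2.
Proof.
elim: n c => [|n IH] c /=; first by rewrite !mul0r; ring.
transitivity (t * bern n t (fun k => (k%:R - n%:R * t - (c + t - 1)) ^+ 2)
   + (1 - t) * bern n t (fun k => (k%:R - n%:R * t - (c + t)) ^+ 2)).
  congr (_ * _ + _ * _); congr bern; apply/funext => k; rewrite -!natr1; ring.
by rewrite !IH -!natr1; ring.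
Qed.

Lemma bern_poly_le n (l : {poly R[i]}) (x t : R) (c : R[i]) (g : nat -> R[i]) :
  0 <= t <= 1 -> l.[x%:C] = t%:C ->
  nrm (c - (bern_poly n l g).[x%:C]) <= bern n t (fun k => nrm (c - g k)).
Proof.
move=> t01 lt; elim: n g => [|n IH] g /=; first by rewrite hornerC.
have /andP[t0 t1] := t01.
rewrite !hornerE lt.
set a := _.[_]; set b := _.[_].
have -> : c - (t%:C * a + (1 - t%:C) * b) = t%:C * (c - a) + (1 - t)%:C * (c - b).
  by rewrite rmorphB rmorph1 /=; ring.
rewrite (le_trans (nrmD _ _)) // !nrmM !nrmR !ger0_norm ?subr_ge0 //.
by rewrite lerD // ler_wpM2l ?subr_ge0 // IH.
Qed.

Lemma weierstrass f (r : R) : continuous f -> forall e : R, 0 < e ->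
  exists p : {poly R[i]}, forall x, `|x| <= r -> nrm (f x - p.[x%:C]) <= e.
Proof.
move=> cf e e0.
pose s : R := `|r| + 1; have s0 : 0 < s by rewrite ltr_wpDl.
have [M M0 hM] := segment_bounded s cf.
have [d d0 hd] := segment_uniform_continuous s cf (divr_gt0 e0 (ltr0n _ 2)).
pose d' := d / (2 * s).
have d'0 : 0 < d' by rewrite divr_gt0 ?mulr_gt0.
(* Makes the Chebyshev term 2 M / (d'^2 n) at most e / 2; d' is d measured in units of the segment
   length 2 s. *)
pose n := (Num.truncn (4 * M / (d' ^+ 2 * e))).+1.
have n0 : (0 : R) < n%:R by rewrite ltr0n.
pose node k : R := - s + 2 * s * (k%:R / n%:R).
pose l : {poly R[i]} := ((2 * s)^-1)%:C *: ('X + (s%:C)%:P).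
exists (bern_poly n l (fun k => f (node k))) => x xr.
have xs : `|x| <= s by rewrite (le_trans xr) // (le_trans (ler_norm r)) // lerDl.
pose t := (x + s) / (2 * s).
have s2 : 0 < 2 * s by rewrite mulr_gt0.
have t01 : 0 <= t <= 1.
  move: xs; rewrite ler_norml => /andP[h1 h2].
  by rewrite ler_pdivlMr // ler_pdivrMr // mul0r mul1r; apply/andP; split; lra.
have xt : x = - s + 2 * s * t by rewrite /t; field; rewrite gt_eqF.
rewrite (le_trans (bern_poly_le _ _ _ t01 _)) //.
  by rewrite !hornerE -rmorphD -rmorphM /= mulrC.
(* Chebyshev's argument: a node close to x costs e / 2 by uniform continuity; for a distant one the
   quadratic term is at least the trivial bound 2 M. *)
pose h k := e / 2 + (2 * M / (d' ^+ 2 * n%:R ^+ 2)) * (k%:R - n%:R * t - 0) ^+ 2.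
have gh k : (k <= n)%N -> nrm (f x - f (node k)) <= h k.
  move=> kn; have k01 : 0 <= (k%:R / n%:R : R) <= 1.
    by rewrite divr_ge0 //= ler_pdivrMr // mul1r ler_nat.
  have ns : `|node k| <= s.
    rewrite ler_norml /node; move: k01 => /andP[]; set u := _ / _ => u0 u1.
    by apply/andP; split; nra.
  have xn : x - node k = 2 * s * (t - k%:R / n%:R) by rewrite xt /node; ring.
  have [lt|le] := ltP `|x - node k| d.
    rewrite /h (le_trans (hd _ _ xs lt)) // lerDl mulr_ge0 ?sqr_ge0 //.
    by rewrite divr_ge0 // mulr_ge0 ?sqr_ge0.
  have le1 : 1 <= (k%:R - n%:R * t - 0) ^+ 2 / (d' ^+ 2 * n%:R ^+ 2).
    have dn0 : 0 <= d' * n%:R by rewrite ltW // mulr_gt0.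
    have D0 : 0 < d' ^+ 2 * n%:R ^+ 2 by rewrite mulr_gt0 // exprn_gt0.
    rewrite (ler_pdivlMr _ _ D0) mul1r -exprMn.
    rewrite -[X in _ <= X]real_normK ?num_real // ler_pXn2r ?nnegrE ?normr_ge0 //.
    have -> : k%:R - n%:R * t - 0 = - (n%:R / (2 * s) * (x - node k)).
      by rewrite xn; field; rewrite !gt_eqF.
    rewrite normrN normrM gtr0_norm ?divr_gt0 // /d'.
    have -> : d / (2 * s) * n%:R = n%:R / (2 * s) * d by ring.
    by rewrite ler_wpM2l // divr_ge0 // (ltW s2).
  rewrite /h (le_trans (nrmB _ _)) //.
  have hx := hM x xs; have hn := hM (node k) ns.
  have : 2 * M <= 2 * M * ((k%:R - n%:R * t - 0) ^+ 2 / (d' ^+ 2 * n%:R ^+ 2)).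
    by rewrite ler_peMr ?mulr_ge0.
  have -> : 2 * M / (d' ^+ 2 * n%:R ^+ 2) * (k%:R - n%:R * t - 0) ^+ 2
    = 2 * M * ((k%:R - n%:R * t - 0) ^+ 2 / (d' ^+ 2 * n%:R ^+ 2)) by ring.
  by lra.
rewrite (le_trans (le_bern t01 gh)) // /h bern_affine bern_variance.
rewrite expr0n addr0 [X in _ <= X]splitr lerD2l.
have tt : t * (1 - t) <= 1.
  by move: t01 => /andP[t0 t1]; rewrite mulr_ile1 // ?subr_ge0 // gerBl.
have -> : 2 * M / (d' ^+ 2 * n%:R ^+ 2) * (n%:R * t * (1 - t))
  = 2 * M / (d' ^+ 2 * n%:R) * (t * (1 - t)) by field; rewrite !gt_eqF.
rewrite (@le_trans _ _ (2 * M / (d' ^+ 2 * n%:R))) //.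
  by rewrite ler_piMr // divr_ge0 // mulr_ge0 ?sqr_ge0.
rewrite ler_pdivrMr; last by rewrite mulr_gt0 // exprn_gt0.
have := @truncnS_gt _ (4 * M / (d' ^+ 2 * e)).
have d2 : 0 < d' ^+ 2 by exact: exprn_gt0.
rewrite -/n (ltr_pdivrMr _ _ (mulr_gt0 d2 e0)) => h1.
set D := d' ^+ 2 in h1 *; nra.
Qed.

End weierstrass.

(** * The continuous functional calculus *)

Section neumann.
Context {R : realType} {H : hilbertType R}.
Implicit Types (A : {linear H -> H}).

Lemma expr_lt (r : R) : 0 <= r < 1 -> forall e : R, 0 < e ->
  exists N, forall n, (N <= n)%N -> r ^+ n <= e.
Proof.
move=> /andP[r0 r1] e e0.
have /cvgrPdist_le/(_ e e0)[N _ hN] : (GRing.exp r : R^nat) @ \oo --> 0.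
  by apply: cvg_expr; rewrite ger0_norm.
exists N => n /hN /=; rewrite sub0r normrN ger0_norm // exprn_ge0 //.
Qed.

Lemma eq0_small (w : H) (c : R) : 0 <= c ->
  (forall e : R, 0 < e -> nrm w <= e * c) -> w = 0.
Proof.
move=> c0 hw; apply/eqP; rewrite -nrm_eq0 eq_le nrm_ge0 andbT.
apply/ler_addgt0Pr => e e0; rewrite add0r.
have c1 : 0 < c + 1 by rewrite ltr_wpDl.
rewrite (le_trans (hw (e / (c + 1)) _)) ?divr_gt0 //.
by rewrite mulrAC ler_pdivrMr // ler_wpM2l ?(ltW e0) // lerDl.
Qed.

(** For |x| > ||A|| the Neumann series inverts A - x. Its partial sums [p n] are polynomials in A,
    so the two inverse identities are the geometric sum in the polynomial ring, up to the remainder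
    (A / x)^n. *)
Lemma spectrum_le A (x : R) : bounded_op A -> spectrum A x%:C ->
  `|x| <= fine (opnorm A).
Proof.
move=> bA sx; rewrite leNgt; apply/negP => ax; apply: sx.
set a := fine _ in ax.
have a0 : 0 <= a by exact: fine_opnorm_ge0.
have x0 : 0 < `|x| by exact: le_lt_trans ax.
have xC0 : x%:C != 0 :> R[i].
  by rewrite -[0]/(0%:C) (inj_eq (@complexI R)) -normr_gt0.
pose r := a / `|x|.
have r01 : 0 <= r < 1 by rewrite divr_ge0 //= ltr_pdivrMr // mul1r.
have /andP[r0 r1] := r01.
pose y : {poly R[i]} := (x^-1)%:C *: 'X.
have yv v : nrm (poly_op y A v) <= r * nrm v.
  rewrite poly_opZ poly_opX nrmZ nrmR normfV /r (mulrC a) -mulrA.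
  by rewrite ler_wpM2l ?invr_ge0 //; exact: bounded_opP.
have yn n v : nrm (poly_op (y ^+ n) A v) <= r ^+ n * nrm v.
  elim: n v => [|n IH] v; first by rewrite !expr0 -polyC1 poly_opC scale1r mul1r.
  by rewrite exprS poly_opM (le_trans (yv _)) // exprS -mulrA ler_wpM2l.
pose p n : {poly R[i]} := - (x^-1)%:C *: \sum_(i < n) y ^+ i.
have pE n : ('X - (x%:C)%:P) * p n = 1 - y ^+ n.
  rewrite -[1](expr1n _ n) subrXX (eq_bigr (fun i : 'I_n => y ^+ i)); last first.
    by move=> i _; rewrite expr1n mul1r.
  rewrite /p -scalerAr scaleNr scalerAl -mulNr; congr (_ * _).
  rewrite scalerBr opprB /y; congr (_ - _).
  by rewrite -mul_polyC -polyCM -rmorphM /= mulVf -?normr_gt0 // polyC1.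
have inv1 n v : A (poly_op (p n) A v) - x%:C *: poly_op (p n) A v
    = v - poly_op (y ^+ n) A v.
  by rewrite -[A _]poly_opX -[x%:C *: _](poly_opC _ A) -poly_opB -poly_opM pE
     poly_opB -polyC1 poly_opC scale1r.
have inv2 n v : poly_op (p n) A (A v - x%:C *: v) = v - poly_op (y ^+ n) A v.
  by rewrite -[A v]poly_opX -[x%:C *: v](poly_opC _ A) -poly_opB -poly_opM mulrC pE
     poly_opB -polyC1 poly_opC scale1r.
have dif N d v : nrm (poly_op (p (N + d)%N) A v - poly_op (p N) A v)
    <= `|x|^-1 * (r ^+ N / (1 - r)) * nrm v.
  have -> : poly_op (p (N + d)%N) A v - poly_op (p N) A v =
     - (x^-1)%:C *: poly_op (\sum_(i < d) y ^+ (N + i)) A v.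
    rewrite -poly_opZ -poly_opB /p -scalerBr; congr (poly_op (_ *: _) A v).
    by rewrite big_split_ord /= addrAC subrr add0r.
  rewrite nrmZ nrmN nrmR normfV -mulrA ler_wpM2l ?invr_ge0 //.
  have -> : poly_op (\sum_(i < d) y ^+ (N + i)) A v = \sum_(i < d) poly_op (y ^+ (N + i)) A v.
    elim: d => [|d IH]; first by rewrite !big_ord0 -polyC0 poly_opC scale0r.
    by rewrite !big_ord_recr poly_opD /= IH.
  rewrite (le_trans (nrm_sum _ _ _)) //.
  have h : \sum_(i < d) r ^+ (N + i) <= r ^+ N / (1 - r).
    under eq_bigr do rewrite exprD.
    rewrite -mulr_sumr ler_wpM2l ?exprn_ge0 // -div1r ler_pdivlMr ?subr_gt0 //.
    have := subrX1 r d; rewrite -{1}opprB -[r - 1]opprB mulNr => /oppr_inj e.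
    by rewrite mulrC -e gerBl exprn_ge0.
  rewrite (le_trans _ (ler_wpM2r (nrm_ge0 v) h)) // mulr_suml.
  by apply: ler_sum => i _; exact: yn.
have [B hB] : exists B : {linear H -> H}, forall e : R, 0 < e ->
    exists N, forall n, (N <= n)%N -> op_le (pop (p n) A \- B) e.
  apply: op_cauchy_lim => e e0.
  have [|N hN] := expr_lt r01 (_ : 0 < (e / 2) * `|x| * (1 - r)).
    by rewrite !mulr_gt0 // subr_gt0.
  have b n v : (N <= n)%N -> nrm (poly_op (p n) A v - poly_op (p N) A v) <= e / 2 * nrm v.
    move=> nN; rewrite -(subnKC nN) (le_trans (dif _ _ _)) // ler_wpM2r ?nrm_ge0 //.
    rewrite ler_pdivrMl // ler_pdivrMr ?subr_gt0 //.
    by rewrite (le_trans (hN _ (leqnn N))) // (mulrC `|x|).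
  exists N => n k nN kN v /=; rewrite /lin_fun.
  rewrite -(subrK (poly_op (p N) A v) (poly_op (p n) A v)) -addrA.
  rewrite (le_trans (nrmD _ _)) // [e]splitr mulrDl lerD ?b //.
  by rewrite nrm_distC b.
have bB : bounded_op B.
  have [N /(_ N (leqnn N)) hN] := hB 1 ltr01.
  have bp := poly_op_bounded (p N) bA.
  apply: (@op_le_bounded _ _ _ (fine (opnorm (pop (p N) A)) + 1)).
    by rewrite addr_ge0 // fine_opnorm_ge0.
  move=> v; rewrite -[B v](subKr (pop (p N) A v)) (le_trans (nrmB _ _)) //.
  by rewrite mulrDl lerD //; [exact: bounded_opP|exact: hN].
exists B; split => // v; apply/eqP; rewrite -subr_eq0; apply/eqP.
  apply: (@eq0_small _ (nrm (A v - x%:C *: v) + nrm v)); first by rewrite addr_ge0 ?nrm_ge0.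
  move=> e e0; have [N1 h1] := hB e e0; have [N2 h2] := expr_lt r01 e0.
  set n := maxn N1 N2.
  have := h1 n (leq_maxl _ _) (A v - x%:C *: v); rewrite /= /lin_fun inv2 => h3.
  have h4 := yn n v; have h5 := h2 n (leq_maxr _ _).
  have -> : B (A v - x%:C *: v) - v = - (v - poly_op (y ^+ n) A v - B (A v - x%:C *: v)) - poly_op (y ^+ n) A v.
    by rewrite opprB -addrA -opprD subrK.
  rewrite (le_trans (nrmB _ _)) // nrmN mulrDr lerD // (le_trans h4) //.
  by rewrite ler_wpM2r ?nrm_ge0.
apply: (@eq0_small _ (a * nrm v + `|x| * nrm v + nrm v)).
  by rewrite !addr_ge0 ?mulr_ge0 ?nrm_ge0.
move=> e e0; have [N1 h1] := hB e e0; have [N2 h2] := expr_lt r01 e0.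
set n := maxn N1 N2.
have := h1 n (leq_maxl _ _) v; rewrite /= /lin_fun => h3.
have h4 := yn n v; have h5 := h2 n (leq_maxr _ _).
set u := poly_op (p n) A v in h3.
have -> : A (B v) - x%:C *: B v - v = - (A (u - B v)) + x%:C *: (u - B v) - poly_op (y ^+ n) A v.
  have e1 := inv1 n v; rewrite -/u in e1.
  have -> : poly_op (y ^+ n) A v = v - (A u - x%:C *: u) by rewrite e1 subKr.
  rewrite linearB scalerBr !opprB /= addrA; congr (_ - v).
  have -> : A (B v) - A u + (x%:C *: u - x%:C *: B v) =
      A (B v) - x%:C *: B v - (A u - x%:C *: u).
    by rewrite opprB addrACA [RHS]addrACA; congr (_ + _); rewrite addrC.
  by rewrite subrK.
rewrite (le_trans (nrmB _ _)) // mulrDr lerD //; last first.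
  by rewrite (le_trans h4) // ler_wpM2r ?nrm_ge0.
rewrite (le_trans (nrmD _ _)) // nrmN nrmZ nrmR mulrDr lerD //.
  by rewrite (le_trans (bounded_opP bA _)) // mulrCA ler_wpM2l.
by rewrite mulrCA ler_wpM2l.
Qed.

End neumann.

Section continuous_calculus.
Context {R : realType} {H : hilbertType R}.
Variable A : {linear H -> H}.
Hypotheses (bA : bounded_op A) (sA : selfadjoint A).
Implicit Types (f g : R -> R[i]^o) (B C : {linear H -> H}).

(** One polynomial per precision replaces the convergent sequence of [is_cfc]. B is an arbitrary
    map, so pointwise sums and compositions can be used before they are packaged as linear maps. *)
Definition cfc_approx f (B : H -> H) := forall e : R, 0 < e ->
  exists p : {poly R[i]},
    (forall x : R, spectrum A x%:C -> nrm (f x - p.[x%:C]) <= e) /\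
    op_le (poly_op p A \- B) e.

Lemma linear_sub_poly p B : linear (poly_op p A \- B).
Proof. by move=> a u v /=; rewrite poly_op_linear linearP scalerBr addrACA opprD. Qed.

Lemma is_cfcP f B : is_cfc A f B <-> cfc_approx f B.
Proof.
split=> [[_ [p [/uniform_cvgP pf pB]]] e e0|h].
  have [N hN] := pf e e0.
  have /opnorm_cvg0 h := pB.
  have [|M hM] := h _ e e0; first by move=> n; exact: linear_sub_poly.
  exists (p (maxn N M)); split; first by apply: hN; exact: leq_maxl.
  by apply: hM; exact: leq_maxr.
split; first by exists B.
have e0 (n : nat) : 0 < n.+1%:R^-1 :> R by rewrite invr_gt0 ltr0n.
have /choice[p hp] : forall n : nat, exists p : {poly R[i]},
    (forall x : R, spectrum A x%:C -> nrm (f x - p.[x%:C]) <= n.+1%:R^-1) /\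
    op_le (poly_op p A \- B) n.+1%:R^-1 by move=> n; exact: h.
have small (e : R) : 0 < e -> exists N, forall n, (N <= n)%N -> n.+1%:R^-1 <= e.
  move=> e1; exists (Num.truncn e^-1) => n nN.
  rewrite -[e]invrK lef_pV2 ?posrE ?invr_gt0 ?ltr0n //.
  by rewrite (le_trans (ltW (truncnS_gt _))) // ler_nat ltnS.
exists p; split.
  apply/uniform_cvgP => e e1; have [N hN] := small e e1.
  exists N => n /hN ne x sx; exact: (le_trans ((hp n).1 x sx)).
apply/opnorm_cvg0; first by move=> n; exact: linear_sub_poly.
move=> e e1; have [N hN] := small e e1; exists N => n /hN ne v.
by rewrite (le_trans ((hp n).2 v)) // ler_wpM2r ?nrm_ge0.
Qed.

Lemma cfc_approx_unique f (B C : H -> H) : cfc_approx f B -> cfc_approx f C -> B =1 C.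
Proof.
move=> hB hC v; apply/eqP; rewrite -subr_eq0; apply/eqP.
apply: (@eq0_small R H _ (4 * nrm v)); first by rewrite mulr_ge0 ?nrm_ge0.
move=> e e0; have [p [p1 p2]] := hB e e0; have [q [q1 q2]] := hC e e0.
have pq : op_le (poly_op (p - q) A) (2 * e).
  apply: poly_op_le => //; first by rewrite mulr_ge0 // ltW.
  move=> x sx; rewrite hornerD hornerN.
  have -> : p.[x%:C] - q.[x%:C] = (f x - q.[x%:C]) - (f x - p.[x%:C]).
    by rewrite opprB [RHS]addrC addrA subrK.
  by rewrite (le_trans (nrmB _ _)) // mulr_natl mulr2n lerD ?p1 ?q1.
have := pq v; rewrite poly_opB; have := p2 v; have := q2 v => /=.
set a := poly_op p A v; set b := poly_op q A v => h1 h2 h3.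
have -> : B v - C v = - (a - B v) + (a - b) + (b - C v).
  by rewrite opprB !addrA !subrK.
rewrite (le_trans (nrmD _ _)) // (le_trans (lerD (nrmD _ _) (lexx _))) // nrmN.
by set x := nrm v in h1 h2 h3 *; lra.
Qed.

Lemma cfc_intro f B : cfc_approx f B -> cfc A f = B.
Proof.
move=> hB; apply: xget_unique; first exact/is_cfcP.
move=> T [[L ->] hL]; apply/funext => v.
apply: (@cfc_approx_unique f L B) => //; apply/is_cfcP; split; [by exists L|exact: hL].
Qed.

(** Weierstrass approximants on [-||A||, ||A||] are uniformly Cauchy on the real spectrum, and
    [poly_op_le] turns this into a Cauchy sequence of operators. *)
Lemma cfc_ex f : continuous f -> exists2 B : {linear H -> H}, cfc A f = B & cfc_approx f B.
Proof.
move=> cf; suff [B hB] : exists B : {linear H -> H}, cfc_approx f B.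
  by exists B => //; exact: cfc_intro.
have e0 (n : nat) : 0 < n.+1%:R^-1 :> R by rewrite invr_gt0 ltr0n.
have /choice[p hp] : forall n : nat, exists p : {poly R[i]},
    forall x : R, `|x| <= fine (opnorm A) -> nrm (f x - p.[x%:C]) <= n.+1%:R^-1.
  by move=> n; exact: weierstrass.
have small (e : R) : 0 < e -> exists N, forall n, (N <= n)%N -> n.+1%:R^-1 <= e.
  move=> e1; exists (Num.truncn e^-1) => n nN.
  rewrite -[e]invrK lef_pV2 ?posrE ?invr_gt0 ?ltr0n //.
  by rewrite (le_trans (ltW (truncnS_gt _))) // ler_nat ltnS.
have [B hB] : exists B : {linear H -> H}, forall e : R, 0 < e ->
    exists N, forall n, (N <= n)%N -> op_le (pop (p n) A \- B) e.
  apply: op_cauchy_lim => e e1; have e2 : 0 < e / 2 by exact: divr_gt0.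
  have [N hN] := small _ e2; exists N => n k nN kN v /=.
  rewrite /lin_fun -poly_opB; move: v; apply: poly_op_le => //; first exact: ltW.
  move=> x /(spectrum_le bA) xa; rewrite hornerD hornerN.
  have -> : (p n).[x%:C] - (p k).[x%:C] = (f x - (p k).[x%:C]) - (f x - (p n).[x%:C]).
    by rewrite opprB [RHS]addrC addrA subrK.
  rewrite (le_trans (nrmB _ _)) // [e]splitr lerD //.
    exact: le_trans (hp _ _ xa) (hN _ kN).
  exact: le_trans (hp _ _ xa) (hN _ nN).
exists B => e e1; have [N1 h1] := small e e1; have [N2 h2] := hB e e1.
exists (p (maxn N1 N2)); split; last by apply: h2; exact: leq_maxr.
move=> x /(spectrum_le bA) xa; apply: le_trans (hp _ _ xa) _.
by apply: h1; exact: leq_maxl.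
Qed.

Lemma cfc_approx_le f (B : H -> H) (M : R) : 0 <= M -> cfc_approx f B ->
  (forall x : R, spectrum A x%:C -> nrm (f x) <= M) -> op_le B M.
Proof.
move=> M0 hB hM v; apply/ler_addgt0Pr => e e0.
have n1 : 0 < 2 * (nrm v + 1) by rewrite mulr_gt0 // ltr_wpDl ?nrm_ge0.
set d := e / (2 * (nrm v + 1)); have d0 : 0 < d by exact: divr_gt0.
have [p [p1 p2]] := hB d d0.
have hp x : spectrum A x%:C -> nrm p.[x%:C] <= M + d.
  move=> sx; rewrite -[p.[_]](subKr (f x)) (le_trans (nrmB _ _)) // lerD //.
    exact: hM.
  exact: p1.
have h1 := poly_op_le bA sA (addr_ge0 M0 (ltW d0)) hp v.
have /= h2 := p2 v.
rewrite -[B v](subKr (poly_op p A v)) (le_trans (nrmB _ _)) //.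
have e1 : 2 * d * (nrm v + 1) = e by rewrite /d; field; rewrite gt_eqF // ltr_wpDl ?nrm_ge0.
have := nrm_ge0 v; rewrite -e1; set x := nrm v in h1 h2 *; nra.
Qed.

Lemma cfc_approxD f g (B C : H -> H) : cfc_approx f B -> cfc_approx g C ->
  cfc_approx (fun x => f x + g x) (B \+ C).
Proof.
move=> hB hC e e0; have e2 : 0 < e / 2 by exact: divr_gt0.
have [p [p1 p2]] := hB _ e2; have [q [q1 q2]] := hC _ e2.
exists (p + q); split => [x sx|v].
  by rewrite hornerD opprD addrACA (le_trans (nrmD _ _)) // [e]splitr lerD ?p1 ?q1.
rewrite /= poly_opD opprD addrACA (le_trans (nrmD _ _)) // [e]splitr mulrDl.
by rewrite lerD //; [exact: p2|exact: q2].
Qed.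

Lemma cfc_approxZ (a : R[i]) f (B : H -> H) : cfc_approx f B ->
  cfc_approx (fun x => a * f x) (a \*: B).
Proof.
move=> hB e e0; have a1 : 0 < nrm a + 1 by rewrite ltr_wpDl ?nrm_ge0.
have le1 (t : R) : t <= e / (nrm a + 1) -> nrm a * t <= e.
  move=> te; rewrite (le_trans (ler_wpM2l (nrm_ge0 a) te)) // mulrA ler_pdivrMr //.
  by rewrite mulrC ler_wpM2l ?(ltW e0) // lerDl.
have [p [p1 p2]] := hB _ (divr_gt0 e0 a1).
exists (a *: p); split => [x sx|v].
  by rewrite hornerZ -mulrBr nrmM le1 // p1.
rewrite /= poly_opZ -scalerBr nrmZ (le_trans (ler_wpM2l (nrm_ge0 a) (p2 v))) //.
by rewrite mulrA ler_wpM2r ?nrm_ge0 // le1.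
Qed.

Lemma cfc_approxM f g (B C : H -> H) (M1 M2 : R) : 0 <= M1 -> 0 <= M2 ->
  (forall x : R, spectrum A x%:C -> nrm (f x) <= M1) ->
  (forall x : R, spectrum A x%:C -> nrm (g x) <= M2) ->
  cfc_approx f B -> cfc_approx g C -> cfc_approx (fun x => f x * g x) (B \o C).
Proof.
move=> M10 M20 hM1 hM2 hB hC e e0.
(* Both the scalar and the operator error of the product are at most d (M1 + M2 + d), with d <=
   1. *)
set K := M1 + M2 + 2; have K0 : 0 < K by rewrite ltr_wpDl ?addr_ge0.
pose d := Num.min 1 (e / K).
have d0 : 0 < d by rewrite lt_min ltr01 divr_gt0.
have d1 : d <= 1 by rewrite ge_min lexx.
have dK : d * K <= e by rewrite -ler_pdivlMr // ge_min lexx orbT.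
have [p [p1 p2]] := hB d d0; have [q [q1 q2]] := hC d d0.
have Cle : op_le C M2.
  exact: cfc_approx_le hC _.
have ple : op_le (poly_op p A) (M1 + d).
  apply: poly_op_le; rewrite ?addr_ge0 // ?ltW // => x sx.
  rewrite -[p.[_]](subKr (f x)) (le_trans (nrmB _ _)) // lerD ?p1 //.
  exact: hM1.
exists (p * q); split => [x sx|v].
  have qx : nrm q.[x%:C] <= M2 + d.
    rewrite -[q.[_]](subKr (g x)) (le_trans (nrmB _ _)) // lerD ?q1 //.
    exact: hM2.
  have fx : nrm (f x) <= M1 by exact: hM1.
  rewrite hornerM.
  have -> : f x * g x - p.[x%:C] * q.[x%:C] =
     f x * (g x - q.[x%:C]) + (f x - p.[x%:C]) * q.[x%:C] :> R[i] by ring.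
  rewrite (le_trans (nrmD _ _)) // !nrmM.
  have h1 := p1 x sx; have h2 := q1 x sx.
  rewrite (le_trans (lerD (ler_pM (nrm_ge0 _) (nrm_ge0 _) fx h2)
     (ler_pM (nrm_ge0 _) (nrm_ge0 _) h1 qx))) //.
  by rewrite (le_trans _ dK) // /K; nra.
rewrite /= poly_opM.
have -> : poly_op p A (poly_op q A v) - B (C v) =
   pop p A (poly_op q A v - C v) + (poly_op p A (C v) - B (C v)).
  by rewrite linearB /= /lin_fun addrA subrK.
rewrite (le_trans (nrmD _ _)) // (le_trans (lerD (ple _) (p2 _))) //.
have h1 := q2 v; have h2 := Cle v; have v0 := nrm_ge0 v; rewrite /= in h1.
rewrite (le_trans _ (ler_wpM2r v0 dK)) //.
have Md : 0 <= M1 + d by rewrite addr_ge0 // ltW.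
rewrite (le_trans (lerD (ler_wpM2l Md h1) (ler_wpM2l (ltW d0) h2))) //.
rewrite !mulrA -mulrDl ler_wpM2r // /K; nra.
Qed.

Lemma cfc_approx_ext f g (B C : H -> H) : f =1 g -> B =1 C ->
  cfc_approx f B -> cfc_approx g C.
Proof. by move=> /funext -> /funext ->. Qed.

Lemma cfc_approx0 : cfc_approx (fun=> 0) (fun=> 0).
Proof.
move=> e e0; exists 0; split => [x _|v]; first by rewrite horner0 subrr nrm0 ltW.
by rewrite /= -polyC0 poly_opC scale0r subrr nrm0 mulr_ge0 ?nrm_ge0 // ltW.
Qed.

Lemma cfc_approx_sum (I : Type) (r : seq I) (f : I -> R -> R[i]^o) (B : I -> H -> H) :
  (forall i, cfc_approx (f i) (B i)) ->
  cfc_approx (fun x => \sum_(i <- r) f i x) (fun v => \sum_(i <- r) B i v).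
Proof.
move=> hB; elim: r => [|i r IH].
  by apply: cfc_approx_ext cfc_approx0 => ?; rewrite big_nil.
by apply: cfc_approx_ext (cfc_approxD (hB i) IH) => ?; rewrite big_cons.
Qed.

Lemma cfc_approx_cst (a : R[i]) : cfc_approx (fun=> a) (a \*: idfun).
Proof.
move=> e e0; exists a%:P; split => [x _|v]; first by rewrite hornerC subrr nrm0 ltW.
by rewrite /= poly_opC subrr nrm0 mulr_ge0 ?nrm_ge0 // ltW.
Qed.

Lemma cfc_approx_id : cfc_approx (fun x => x%:C) A.
Proof.
move=> e e0; exists 'X; split => [x _|v]; first by rewrite hornerX subrr nrm0 ltW.
by rewrite /= poly_opX subrr nrm0 mulr_ge0 ?nrm_ge0 // ltW.
Qed.

End continuous_calculus.

(** * Differences of products of resolvents *)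

Section finite_difference.
Context {K : nzRingType} {V : lmodType K}.
Implicit Types F : nat -> V.

Definition fdseq F (j : nat) : V := F j.+1 - F j.

Lemma iter_fdseqE m F j : iter m fdseq F j =
  \sum_(0 <= i < m.+1) ((-1) ^+ (m - i) * 'C(m, i)%:R) *: F (j + i)%N.
Proof.
elim: m j => [|m IH] j.
  by rewrite big_nat1 subnn bin0 expr0 mulr1 scale1r addn0.
rewrite iterS /fdseq !IH !big_mkord.
have -> : \sum_(i < m.+1) ((-1) ^+ (m - i) * 'C(m, i)%:R) *: F (j + i)%N =
   \sum_(i < m.+2) ((-1) ^+ (m - i) * 'C(m, i)%:R) *: F (j + i)%N.
  by rewrite [RHS]big_ord_recr /= bin_small // mulr0 scale0r addr0.
rewrite [X in _ - X]big_ord_recl [RHS]big_ord_recl /= opprD addrCA -sumrB; congr (_ + _).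
  by rewrite !subn0 !bin0 !mulr1 exprS mulN1r scaleNr.
apply: eq_bigr => i _; rewrite /bump /= !add1n subSS addSnnS -scalerBl.
congr (_ *: _); rewrite binS natrD mulrDr addrC; congr (_ + _).
have [im|im] := ltnP i m; last by rewrite bin_small // !mulr0 oppr0.
by rewrite -[in RHS](subnSK im) exprS mulN1r mulNr.
Qed.

End finite_difference.

(* A word stands for the product of its letters [R_e(A + (j + c) K) X], where X
   is K' or the identity according to the last component of the letter (e, c, x). *)
Section words.
Context {R : realType} {H : hilbertType R} (n : nat).
Variables (Rs : bool -> nat -> 'I_n -> {linear H -> H}) (K' : {linear H -> H}).
Variables (kap C : R).
Hypotheses (kap0 : 0 <= kap) (C0 : 0 <= C).
(** The second resolvent identity. In the application [Rs e j k] inverts (A + j K - y_k) / s + i or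
    - i, and K' = - K / s. *)
Hypothesis resolventE : forall e j k v,
  Rs e j.+1 k v - Rs e j k v = Rs e j.+1 k (K' (Rs e j k v)).
Hypothesis Rs_le1 : forall e j k v, nrm (Rs e j k v) <= nrm v.
Hypothesis K'_le : forall v, nrm (K' v) <= kap * nrm v.
Hypothesis Rs_sq : forall e j v, \sum_k nrm (Rs e j k v) ^+ 2 <= C * nrm v ^+ 2.
Hypothesis Rs_adj : forall e j k u v, inner (Rs e j k u) v = inner u (Rs (~~ e) j k v).

Definition letter := (bool * nat * bool)%type.

Fixpoint weval (w : seq letter) (k : 'I_n) (v : H) (j : nat) : H :=
  if w is (e, c, x) :: w' then
    Rs e (j + c)%N k (if x then K' (weval w' k v j) else weval w' k v j)
  else v.

(** Leibniz rule for differences, F(j+1) G(j+1) - F(j) G(j) = (F(j+1) - F(j)) G(j) + F(j+1) (G(j+1)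
    - G(j)), F being the outer letter. By the resolvent identity, differencing that letter splits it
    in two with K' in between. *)
Fixpoint dword (w : seq letter) : seq (seq letter) :=
  if w is (e, c, x) :: w' then
    [:: (e, c.+1, true), (e, c, x) & w'] ::
      [seq (e, c.+1, x) :: w'' | w'' <- dword w']
  else [::].

Fixpoint dwords (d : nat) (w : seq letter) : seq (seq letter) :=
  if d is d'.+1 then flatten [seq dword w' | w' <- dwords d' w] else [:: w].

Lemma fdseq_weval w k v j :
  fdseq (weval w k v) j = \sum_(w' <- dword w) weval w' k v j.
Proof.
elim: w => [|[[e c] x] w IH] /=; first by rewrite big_nil /fdseq subrr.
rewrite big_cons big_map /= -linear_sum /= /fdseq /= !addnS addSn.
set z := weval w k v j.
have -> : weval w k v j.+1 = z + \sum_(w' <- dword w) weval w' k v j.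
  by rewrite -IH /fdseq addrC subrK.
case: x => /=.
  by rewrite !linearD /= addrAC -resolventE linear_sum /= linear_sum.
by rewrite !linearD /= addrAC -resolventE linear_sum.
Qed.

Lemma iter_fdseq_weval d w k v j :
  iter d fdseq (weval w k v) j = \sum_(w' <- dwords d w) weval w' k v j.
Proof.
elim: d j => [|d IH] j; first by rewrite big_seq1.
rewrite iterS /fdseq !IH -sumrB /= big_flatten /= big_map.
by apply: eq_bigr => w' _; rewrite -fdseq_weval.
Qed.

Definition wK (w : seq letter) : nat := count (fun l => l.2) w.

(** The innermost letter has to be a bare resolvent acting on u, so that [Rs_sq] applies to it.
    Differencing preserves this: a split puts K' to the left of a copy of the letter. *)
Fixpoint ends_plain (w : seq letter) : bool :=
  if w is l :: w' then (if w' is _ :: _ then ends_plain w' else ~~ l.2) else false.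

Lemma dword_prop w w' : w' \in dword w -> ends_plain w ->
  [/\ ends_plain w', wK w' = (wK w).+1 & size w' = (size w).+1].
Proof.
elim: w w' => [|[[e c] x] w IH] w' //=.
rewrite inE => /orP[/eqP -> g|].
  by split => //=; rewrite ?add1n ?add1n.
case/mapP => w'' w''w -> g.
have gw : ends_plain w by case: (w) g w''w.
have [g1 g2 g3] := IH _ w''w gw.
split => /=; last by rewrite g3.
  by case: (w'') g1.
by rewrite -/(wK _) g2 addnS.
Qed.

Lemma dwords_prop d w w' : w' \in dwords d w -> ends_plain w ->
  [/\ ends_plain w', wK w' = (wK w + d)%N & size w' = (size w + d)%N].
Proof.
elim: d w' => [|d IH] w' /=; first by rewrite inE => /eqP -> g; rewrite !addn0.
case/flattenP => _ /mapP[w1 w1w ->] w'w1 g.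
have [g1 g2 g3] := IH _ w1w g.
have [h1 h2 h3] := dword_prop w'w1 g1.
by rewrite h2 h3 g2 g3 !addnS.
Qed.

Lemma weval_le w : ends_plain w -> exists e c, forall j k u,
  nrm (weval w k u j) <= kap ^+ wK w * nrm (Rs e (j + c)%N k u).
Proof.
elim: w => [|[[e c] x] w IH] //=.
case: w IH => [_|l w IH] /=.
  by move=> /negbTE ->; exists e, c => j k u; rewrite expr0 mul1r.
move=> /IH [e' [c' h]]; exists e', c' => j k u; move: (h j k u).
set z := weval _ _ _ _ => {}h.
rewrite (le_trans (Rs_le1 _ _ _ _)) //; case: x => //=.
by rewrite (le_trans (K'_le _)) // add1n exprS -mulrA ler_wpM2l.
Qed.

(* Cauchy-Schwarz on the two outer letters of the word; the inner ones are
   contractions *)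
Lemma word_bound w j u v : ends_plain w -> (1 < size w)%N -> nrm u <= 1 -> nrm v <= 1 ->
  \sum_k nrm (inner (weval w k u j) v) <= kap ^+ wK w * C.
Proof.
case: w => [|[[e c] x] w] //= gw; case: w gw => // l w gw _ u1 v1.
have [e' [c' h]] := @weval_le (l :: w) gw.
set w' := l :: w in gw h *; set N := (x + _)%N.
have key k : nrm (inner (Rs e (j + c)%N k (if x then K' (weval w' k u j) else weval w' k u j)) v)
    <= kap ^+ N * ((nrm (Rs e' (j + c')%N k u) ^+ 2 + nrm (Rs (~~ e) (j + c)%N k v) ^+ 2) / 2).
  rewrite Rs_adj (le_trans (cauchy_schwarz _ _)) //.
  set a := nrm (Rs e' _ _ _); set b := nrm (Rs (~~ e) _ _ _).
  have b0 : 0 <= b by exact: nrm_ge0.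
  have ab : a * b <= (a ^+ 2 + b ^+ 2) / 2.
    by have := sqr_ge0 (a - b); rewrite ler_pdivlMr // sqrrB; lra.
  rewrite (le_trans _ (ler_wpM2l (exprn_ge0 N kap0) ab)) // mulrA ler_wpM2r //.
  move: (h j k u); rewrite /N; set z := weval w' k u j => hz.
  case: (x); last exact: hz.
  by rewrite (le_trans (K'_le _)) // add1n exprS -mulrA ler_wpM2l.
rewrite (le_trans (ler_sum _ (fun k _ => key k))) // -mulr_sumr -mulr_suml.
rewrite ler_wpM2l ?exprn_ge0 // ler_pdivrMr // mulr_natr mulr2n big_split /= lerD //.
  rewrite (le_trans (Rs_sq _ _ _)) // ler_piMr // exprn_ile1 ?nrm_ge0 //.
rewrite (le_trans (Rs_sq _ _ _)) // ler_piMr // exprn_ile1 ?nrm_ge0 //.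
Qed.

Lemma fdseq_word_bound d (h : 'I_n -> R[i]) (b : R) w : ends_plain w -> (1 < size w)%N ->
  0 <= b -> (forall k, nrm (h k) <= b) ->
  op_le (fun u => iter d fdseq (fun j => \sum_k h k *: weval w k u j) 0%N)
    ((size (dwords d w))%:R * b * (kap ^+ (wK w + d) * C)).
Proof.
move=> gw sw b0 hb; set M := _ * b * _.
have M0 : 0 <= M by rewrite !mulr_ge0 ?exprn_ge0.
set L := fun u : H => _.
have LE u : L u = \sum_(w' <- dwords d w) \sum_k h k *: weval w' k u 0%N.
  rewrite /L exchange_big /=; set F := fun j => _.
  suff e j : iter d fdseq F j = \sum_k h k *: iter d fdseq (weval w k u) j.
    by rewrite e; apply: eq_bigr => k _; rewrite iter_fdseq_weval scaler_sumr.
  elim: d j {M M0 L} => [//|d IH] j; rewrite iterS /fdseq !IH -sumrB.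
  by apply: eq_bigr => k _; rewrite iterS -scalerBr.
(* [word_bound] rests on a b <= (a^2 + b^2) / 2, which is not homogeneous; hence unit vectors here,
   and the homogeneity [LZ] for the general case. *)
have unit_bound u v : nrm u <= 1 -> nrm v <= 1 -> nrm (inner (L u) v) <= M.
  move=> u1 v1; rewrite LE inner_suml (le_trans (nrm_sum _ _ _)) //.
  have -> : M = \sum_(w' <- dwords d w) (b * (kap ^+ (wK w + d) * C)).
    by rewrite big_const_seq count_predT iter_addr_0 /M -mulrA mulr_natl.
  rewrite big_seq_cond [X in _ <= X]big_seq_cond; apply: ler_sum => w'.
  rewrite andbT => /dwords_prop/(_ gw)[g1 g2 g3].
  rewrite inner_suml (le_trans (nrm_sum _ _ _)) // -g2.
  rewrite (le_trans _ (ler_wpM2l b0 (word_bound 0 g1 _ u1 v1))) //; last first.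
    by rewrite g3 (leq_trans sw) // leq_addr.
  rewrite mulr_sumr; apply: ler_sum => k _.
  by rewrite innerZl nrmM ler_wpM2r ?nrm_ge0.
have LZ (a : R[i]) u : L (a *: u) = a *: L u.
  have wZ w' k j : weval w' k (a *: u) j = a *: weval w' k u j.
    by elim: w' => [//|[[e c] x] w' IH] /=; rewrite IH; case: x; rewrite !linearZ.
  rewrite !LE scaler_sumr; apply: eq_bigr => w' _; rewrite scaler_sumr.
  by apply: eq_bigr => k _; rewrite wZ !scalerA mulrC.
have normalize (v : H) : exists2 v', nrm v' <= 1 & v = (nrm v)%:C *: v'.
  have [->|v0] := eqVneq v 0; first by exists 0; rewrite ?nrm0 ?scale0r ?ler01.
  have nv0 : nrm v != 0 by rewrite nrm_eq0.
  exists ((nrm v)^-1%:C *: v).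
    by rewrite nrmZ nrmR ger0_norm ?invr_ge0 ?nrm_ge0 // mulVf.
  by rewrite scalerA -rmorphM /= divff // scale1r.
move=> u; apply: nrm_innerP; first by rewrite mulr_ge0 ?nrm_ge0.
move=> v; have [u' u1 uE] := normalize u; have [v' v1 vE] := normalize v.
rewrite {1}uE LZ {1}vE innerZl innerZr !nrmM nrm_conj !nrmR !ger0_norm ?nrm_ge0 //.
have -> : M * nrm u * nrm v = nrm u * (nrm v * M) by ring.
by rewrite !ler_wpM2l ?nrm_ge0 // unit_bound.
Qed.

End words.

(** * Resolvents of the operators A + j K *)

Section resolvents.
Context {R : realType}.

(** This is 1 / (t + i) for [true] and 1 / (t - i) for [false]; negating e is complex
    conjugation. *)
Definition rfun (e : bool) (t : R) : R[i] := (Complex t ((-1) ^+ ~~ e))^-1.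

Lemma nrm_complex_sqr (a b : R) : nrm (Complex a b) ^+ 2 = a ^+ 2 + b ^+ 2.
Proof. by rewrite /nrm normc_def /= sqr_sqrtr // addr_ge0 ?sqr_ge0. Qed.

Lemma nrm_rden_ge1 e (t : R) : 1 <= nrm (Complex t ((-1) ^+ ~~ e)).
Proof.
rewrite -(ler_pXn2r (n := 2)) ?nnegrE ?nrm_ge0 // expr1n nrm_complex_sqr.
by rewrite sqrr_sign lerDr sqr_ge0.
Qed.

Lemma rden_neq0 e (t : R) : Complex t ((-1) ^+ ~~ e) != 0.
Proof. by rewrite -nrm_eq0 gt_eqF // (lt_le_trans ltr01) // nrm_rden_ge1. Qed.

Lemma nrm_rfun_le1 e t : nrm (rfun e t) <= 1.
Proof. by rewrite nrmV invf_le1 ?nrm_rden_ge1 // (lt_le_trans ltr01) // nrm_rden_ge1. Qed.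

Lemma rfunM e t : rfun e t * rfun (~~ e) t = ((1 + t ^+ 2)^-1)%:C.
Proof.
rewrite -invfM [RHS]fmorphV /=; congr (_^-1).
apply/eqP; rewrite eq_complex /=; apply/andP; split; apply/eqP; case: e => /=; ring.
Qed.

Lemma rfun_continuous e (s y : R) : 0 < s ->
  continuous (fun x => rfun e ((x - y) / s) : R[i]^o).
Proof.
move=> s0; apply/continuous_nrm => x d d0; exists (s * d); first exact: mulr_gt0.
move=> z xz; rewrite /rfun.
set a := Complex _ _; set b := Complex _ _.
have a0 : a != 0 by exact: rden_neq0.
have b0 : b != 0 by exact: rden_neq0.
have -> : a^-1 - b^-1 = (b - a) * (a^-1 * b^-1).
  by rewrite mulrBl mulrCA divff // mulr1 mulrA divff // mul1r.
have ba : b - a = ((z - x) / s)%:C.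
  apply/eqP; rewrite eq_complex /=; apply/andP; split; apply/eqP; last by rewrite subrr.
  by rewrite -mulrBl; congr (_ / _); ring.
rewrite ba !nrmM nrmR.
have ab1 : nrm a^-1 * nrm b^-1 <= 1 by rewrite mulr_ile1 ?nrm_ge0 ?nrm_rfun_le1.
rewrite (le_lt_trans (ler_wpM2l (normr_ge0 _) ab1)) // mulr1 normrM normfV (gtr0_norm s0).
by rewrite ltr_pdivrMr // distrC mulrC.
Qed.

Context {H : hilbertType R}.
Implicit Types A K : {linear H -> H}.

Definition rshift A (s y : R) (e : bool) (v : H) : H :=
  (s^-1)%:C *: (A v - y%:C *: v) + Complex 0 ((-1) ^+ ~~ e) *: v.

Lemma rshift_adj A (s y : R) e u v : selfadjoint A ->
  inner (rshift A s y e u) v = inner u (rshift A s y (~~ e) v).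
Proof.
move=> sA; rewrite /rshift !(innerDl, innerDr, innerZl, innerZr, innerNl, innerNr).
rewrite (sA u v) !conjc_real; congr (_ + _ * _); apply/eqP; rewrite eq_complex /=.
by rewrite eqxx /=; case: e => /=; rewrite ?expr0 ?expr1 ?opprK.
Qed.

(** The inverse is taken from the functional calculus: [rfun] times its denominator is 1, and
    multiplicativity makes the operators inverse to each other. Thus the same B has a known
    symbol. *)
Lemma resolvent_ex A (s y : R) e : bounded_op A -> selfadjoint A -> 0 < s ->
  exists B : {linear H -> H},
    [/\ cfc_approx A (fun x => rfun e ((x - y) / s)) B,
        forall v, rshift A s y e (B v) = v & forall v, B (rshift A s y e v) = v].
Proof.
move=> bA sA s0; have [B _ hB] := cfc_ex bA sA (@rfun_continuous e s y s0).
pose den x : R[i] := Complex ((x - y) / s) ((-1) ^+ ~~ e).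
have hQ : cfc_approx A (den : R -> R[i]^o) (rshift A s y e).
  apply: cfc_approx_ext (cfc_approxD (cfc_approxZ (s^-1)%:C
    (cfc_approxD (cfc_approx_id A) (cfc_approx_cst A (- y%:C))))
    (cfc_approx_cst A (Complex 0 ((-1) ^+ ~~ e)))) => [x|v].
    by apply/eqP; rewrite eq_complex /=; apply/andP; split; apply/eqP; ring.
  by rewrite /rshift /= scaleNr.
set M := (fine (opnorm A) + `|y|) / s + 1.
have M0 : 0 <= M.
  by rewrite addr_ge0 // divr_ge0 ?(ltW s0) // addr_ge0 ?fine_opnorm_ge0.
have hM x : spectrum A x%:C -> nrm (den x) <= M.
  move=> /(spectrum_le bA) xa; apply: (@le_trans _ _ (`|(x - y) / s| + 1)).
    rewrite -(ler_pXn2r (n := 2)) ?nnegrE ?nrm_ge0 ?addr_ge0 // nrm_complex_sqr.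
    rewrite sqrr_sign sqrrD real_normK ?num_real // expr1n mulr1.
    by rewrite -addrA lerD2l lerDr mulrn_wge0.
  rewrite lerD2r normrM normfV (gtr0_norm s0) ler_wpM2r ?invr_ge0 ?(ltW s0) //.
  by rewrite (le_trans (ler_normB _ _)) // lerD2r.
have h1 x : spectrum A x%:C -> nrm (rfun e ((x - y) / s)) <= 1.
  by move=> _; exact: nrm_rfun_le1.
have one (C : H -> H) : cfc_approx A (fun=> 1) C -> forall v, C v = v.
  move=> hC v; rewrite (cfc_approx_unique bA sA hC (cfc_approx_cst A 1)) /=.
  exact: scale1r.
exists B; split => //; apply: one.
  apply: cfc_approx_ext (cfc_approxM bA sA M0 ler01 hM h1 hQ hB) => // x.
  by rewrite /rfun mulfV // rden_neq0.
apply: cfc_approx_ext (cfc_approxM bA sA ler01 M0 h1 hM hB hQ) => // x.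
by rewrite /rfun mulVf // rden_neq0.
Qed.

Definition oshift A K (j : nat) : {linear H -> H} := A \+ (j%:R : R[i]) \*: K.

Lemma oshift_selfadjoint A K j : selfadjoint A -> selfadjoint K ->
  selfadjoint (oshift A K j).
Proof.
move=> sA sK u v; rewrite /= innerDl innerDr innerZl innerZr sA sK.
by rewrite conjc_nat.
Qed.

Lemma oshift_le A K j : bounded_op A -> bounded_op K ->
  op_le (oshift A K j) (fine (opnorm A) + j%:R * fine (opnorm K)).
Proof.
move=> bA bK v; rewrite /= (le_trans (nrmD _ _)) // mulrDl lerD ?bounded_opP //.
by rewrite nrmZ nrm_nat -mulrA ler_wpM2l // bounded_opP.
Qed.

Lemma oshift_bounded A K j : bounded_op A -> bounded_op K ->
  bounded_op (oshift A K j).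
Proof.
move=> bA bK; apply: op_le_bounded (oshift_le j bA bK).
by rewrite addr_ge0 ?mulr_ge0 ?fine_opnorm_ge0.
Qed.

End resolvents.

(** m + 1 pairs of conjugate resolvents, each pair with symbol 1 / (1 + t^2): the word of the kernel
    [phi m]. *)
Fixpoint base_word (m : nat) : seq letter :=
  if m is m'.+1 then [:: (true, 0%N, false), (false, 0%N, false) & base_word m']
  else [:: (true, 0%N, false); (false, 0%N, false)].

Lemma base_word_prop m :
  [/\ ends_plain (base_word m), wK (base_word m) = 0%N & (1 < size (base_word m))%N].
Proof. by elim: m => [//|[//|m] [g k s]]; split. Qed.

(** * Operator differences of a sum of kernels *)

Section bernstein.
Context {R : realType} {H : hilbertType R}.
Variables (A K : {linear H -> H}).
Hypotheses (bA : bounded_op A) (sA : selfadjoint A).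
Hypotheses (bK : bounded_op K) (sK : selfadjoint K).
Variables (m n : nat) (s : R) (y : 'I_n -> R) (h : 'I_n -> R[i]) (b C : R).
Hypotheses (s0 : 0 < s) (b0 : 0 <= b) (hb : forall k, nrm (h k) <= b).
Hypothesis sumC : forall x, \sum_k (1 + ((x - y k) / s) ^+ 2)^-1 <= C.

Definition phi (t : R) : R := (1 + t ^+ 2)^-1 ^+ m.+1.

Definition phi_sum : R -> R[i]^o := fun x => \sum_k h k * (phi ((x - y k) / s))%:C.

Let bAK j := oshift_bounded j bA bK.
Let sAK j := oshift_selfadjoint j sA sK.

Lemma phi_sum_cfc : exists2 B : nat -> {linear H -> H},
  forall j, cfc_approx (oshift A K j) phi_sum (B j) &
  op_le (fun u => iter m fdseq (fun j => B j u) 0%N)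
    ((size (dwords m (base_word m)))%:R * b * C * (fine (opnorm K) / s) ^+ m).
Proof.
pose Rs e j k := projT1 (cid (@resolvent_ex _ _ (oshift A K j) s (y k) e (bAK j) (sAK j) s0)).
have RsP e j k : [/\ cfc_approx (oshift A K j) (fun x => rfun e ((x - y k) / s)) (Rs e j k),
   forall v, rshift (oshift A K j) s (y k) e (Rs e j k v) = v &
   forall v, Rs e j k (rshift (oshift A K j) s (y k) e v) = v].
  by rewrite /Rs; case: cid.
pose K' : {linear H -> H} := (- s^-1)%:C \*: K.
pose kap := fine (opnorm K) / s.
have kap0 : 0 <= kap by rewrite divr_ge0 ?fine_opnorm_ge0 // ltW.
have C0 : 0 <= C.
  rewrite (le_trans _ (sumC 0)) // sumr_ge0 // => k _.
  by rewrite invr_ge0 addr_ge0 ?sqr_ge0.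
have shiftS e j k v : rshift (oshift A K j) s (y k) e v - rshift (oshift A K j.+1) s (y k) e v
    = K' v.
  rewrite /rshift /= opprD addrACA subrr addr0 -scalerBr opprD addrACA subrr addr0.
  rewrite -natr1 scalerDl scale1r opprD addrACA subrr add0r opprD addrA subrr sub0r.
  by rewrite rmorphN /= scaleNr scalerN.
have resE e j k v : Rs e j.+1 k v - Rs e j k v = Rs e j.+1 k (K' (Rs e j k v)).
  have [_ QR RQ] := RsP e j k; have [_ QR' RQ'] := RsP e j.+1 k.
  by rewrite -(shiftS e j k) linearB QR RQ'.
have Rle e j k v : nrm (Rs e j k v) <= nrm v.
  have [hR _ _] := RsP e j k.
  have := cfc_approx_le (bAK j) (sAK j) ler01 hR.
  by move=> /(_ (fun _ _ => nrm_rfun_le1 _ _))/(_ v); rewrite mul1r.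
have K'le v : nrm (K' v) <= kap * nrm v.
  rewrite /= nrmZ nrmR normrN normfV (gtr0_norm s0) /kap mulrAC mulrC.
  by rewrite ler_wpM2r ?invr_ge0 ?(ltW s0) // bounded_opP.
have Radj e j k u v : inner (Rs e j k u) v = inner u (Rs (~~ e) j k v).
  have [_ QR _] := RsP e j k; have [_ QR' _] := RsP (~~ e) j k.
  by rewrite -{1}(QR' v) -{2}(QR u) rshift_adj.
(* The sum of squares is the quadratic form of [Phi], the sum over k of R_k* R_k, whose symbol is
   the sum bounded by C in [sumC]. *)
have Rsq e j v : \sum_k nrm (Rs e j k v) ^+ 2 <= C * nrm v ^+ 2.
  pose Phi (v : H) := \sum_k Rs (~~ e) j k (Rs e j k v).
  have hPhi : cfc_approx (oshift A K j)
      (fun x => \sum_k rfun (~~ e) ((x - y k) / s) * rfun e ((x - y k) / s)) Phi.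
    apply: cfc_approx_sum => k; apply: (cfc_approxM (bAK j) (sAK j) ler01 ler01).
    - by move=> x _; exact: nrm_rfun_le1.
    - by move=> x _; exact: nrm_rfun_le1.
    - by have [] := RsP (~~ e) j k.
    - by have [] := RsP e j k.
  have : op_le Phi C.
    apply: (cfc_approx_le (bAK j) (sAK j) C0 hPhi) => x _.
    rewrite (eq_bigr (fun k => ((1 + ((x - y k) / s) ^+ 2)^-1)%:C)); last first.
      by move=> k _; rewrite mulrC rfunM.
    rewrite -rmorph_sum /= nrmR ger0_norm ?sumC // sumr_ge0 // => k _.
    by rewrite invr_ge0 addr_ge0 ?sqr_ge0.
  move=> /(_ v) PhiC.
  have PhiE : inner (Phi v) v = (\sum_k nrm (Rs e j k v) ^+ 2)%:C.
    rewrite rmorph_sum inner_suml; apply: eq_bigr => k _.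
    by rewrite /= Radj negbK inner_nrm.
  rewrite (le_trans (ler_norm _)) // -nrmR -PhiE (le_trans (cauchy_schwarz _ _)) //.
  by rewrite expr2 mulrA ler_wpM2r ?nrm_ge0.
have RsA e j k : cfc_approx (oshift A K j) (fun x => rfun e ((x - y k) / s)) (Rs e j k).
  by have [] := RsP e j k.
pose w := base_word m; have [gw kw sw] := base_word_prop m.
have hw j k : cfc_approx (oshift A K j) (fun x => (phi ((x - y k) / s))%:C)
    (fun v => weval Rs K' w k v j).
  rewrite /w /phi; elim: (m) => [|m' IH]; cbn [base_word weval]; rewrite addn0.
    apply: cfc_approx_ext (cfc_approxM (bAK j) (sAK j) ler01 ler01
      (fun _ _ => nrm_rfun_le1 _ _) (fun _ _ => nrm_rfun_le1 _ _)
      (RsA true j k) (RsA false j k)) => // x.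
    by rewrite (rfunM true) expr1.
  have phi1 (t : R) d : nrm (((1 + t ^+ 2)^-1 ^+ d)%:C : R[i]) <= 1.
    have t1 : 1 <= 1 + t ^+ 2 by rewrite lerDl sqr_ge0.
    rewrite rmorphXn nrmX exprn_ile1 ?nrm_ge0 // nrmR normfV ger0_norm; last exact: le_trans t1.
    by rewrite invf_le1 // (lt_le_trans ltr01).
  have h2 := cfc_approxM (bAK j) (sAK j) ler01 ler01
      (fun _ _ => nrm_rfun_le1 _ _) (fun _ _ => phi1 _ _) (RsA false j k) IH.
  have h2le (x : R) : spectrum (oshift A K j) x%:C ->
      nrm (rfun false ((x - y k) / s) * ((1 + ((x - y k) / s) ^+ 2)^-1 ^+ m'.+1)%:C) <= 1.
    by move=> _; rewrite nrmM mulr_ile1 ?nrm_ge0 // nrm_rfun_le1.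
  apply: cfc_approx_ext (cfc_approxM (bAK j) (sAK j) ler01 ler01
      (fun _ _ => nrm_rfun_le1 _ _) h2le (RsA true j k) h2) => // x.
  by rewrite mulrA (rfunM true) [in RHS]exprS -rmorphM.
have wlin k j : linear (fun v => weval Rs K' w k v j).
  by move=> a u v; elim: (w) => [//|[[e c] [|]] w' IH] /=; rewrite IH !linearP.
have lw j : linear (fun v => \sum_k h k *: weval Rs K' w k v j).
  move=> a u v; rewrite scaler_sumr -big_split; apply: eq_bigr => k _ /=.
  by rewrite wlin scalerDr !scalerA mulrC.
exists (fun j => lin_fun (lw j)) => [j|u /=].
  by apply: cfc_approx_sum => k; exact: cfc_approxZ.
have := fdseq_word_bound kap0 C0 resE Rle K'le Rsq Radj m gw sw b0 hb u.
by rewrite kw add0n -mulrA (mulrC _ C) !mulrA.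
Qed.

End bernstein.

(** * The kernel *)

Section kernel.
Context {R : realType}.
Implicit Types (t u x : R).

Lemma inv1sqr_gt0 t : 0 < (1 + t ^+ 2)^-1.
Proof. by rewrite invr_gt0 ltr_pwDl ?sqr_ge0. Qed.

(** The bound is relative to the value at u, so that it can be summed over a lattice. It comes from
    |t + u| <= 2 |t| + 1 <= 2 (1 + t^2). *)
Lemma inv1sqr_lip t u : `|t - u| <= 1 ->
  `|(1 + t ^+ 2)^-1 - (1 + u ^+ 2)^-1| <= 2 * `|t - u| * (1 + u ^+ 2)^-1.
Proof.
move=> tu; have t0 : 0 < 1 + t ^+ 2 by rewrite ltr_pwDl ?sqr_ge0.
have u0 : 0 < 1 + u ^+ 2 by rewrite ltr_pwDl ?sqr_ge0.
have -> : (1 + t ^+ 2)^-1 - (1 + u ^+ 2)^-1 =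
   (u - t) * ((u + t) * (1 + t ^+ 2)^-1) * (1 + u ^+ 2)^-1.
  by field; rewrite !gt_eqF.
rewrite !normrM (gtr0_norm (inv1sqr_gt0 u)) ler_wpM2r ?(ltW (inv1sqr_gt0 u)) //.
rewrite distrC mulrC ler_wpM2r // (gtr0_norm (inv1sqr_gt0 t)) ler_pdivrMr //.
have -> : u + t = 2 * t - (t - u) by ring.
rewrite (le_trans (ler_normB _ _)) // normrM ger0_norm // -[t ^+ 2]real_normK ?num_real //.
by have := sqr_ge0 (`|t| - 1); nra.
Qed.

Lemma inv1sqr_le3 t u : `|t - u| <= 1 -> (1 + t ^+ 2)^-1 <= 3 * (1 + u ^+ 2)^-1.
Proof.
move=> tu; have := inv1sqr_lip tu; have u0 := inv1sqr_gt0 u.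
move=> /(le_trans (ler_norm _)); set a := (1 + t ^+ 2)^-1; set b := (1 + u ^+ 2)^-1 in u0 *.
by nra.
Qed.

Variable m : nat.

Lemma phi_gt0 t : 0 < phi m t.
Proof. by rewrite exprn_gt0 // inv1sqr_gt0. Qed.

Lemma phi_lip t u : `|t - u| <= 1 ->
  `|phi m t - phi m u| <= 3 ^+ m.+1 * `|t - u| * phi m u.
Proof.
move=> tu; rewrite /phi; set a := (1 + t ^+ 2)^-1; set b := (1 + u ^+ 2)^-1.
have a0 : 0 < a by exact: inv1sqr_gt0.
have b0 : 0 < b by exact: inv1sqr_gt0.
have a3 : a <= 3 * b by exact: inv1sqr_le3.
have ab : `|a - b| <= 2 * `|t - u| * b by exact: inv1sqr_lip.
(* The constant 3^q - 1 reproduces itself: 3 (3^q - 1) + 2 = 3^(q+1) - 1. *)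
suff : forall q, `|a ^+ q - b ^+ q| <= (3 ^+ q - 1) * `|t - u| * b ^+ q.
  move=> /(_ m.+1)/le_trans; apply; rewrite ler_wpM2r ?exprn_ge0 ?(ltW b0) //.
  by rewrite ler_wpM2r // gerBl.
elim=> [|q IH]; first by rewrite !expr0 !subrr normr0 mul0r mul0r.
have -> : a ^+ q.+1 - b ^+ q.+1 = a * (a ^+ q - b ^+ q) + (a - b) * b ^+ q.
  by rewrite !exprS; ring.
rewrite (le_trans (ler_normD _ _)) // !normrM (gtr0_norm a0) (gtr0_norm (exprn_gt0 q b0)).
have h1 := ler_pM (ltW a0) (normr_ge0 _) a3 IH.
have h2 := ler_wpM2r (exprn_ge0 q (ltW b0)) ab.
rewrite (le_trans (lerD h1 h2)) // !exprS; lra.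
Qed.

Lemma phi_le_inv1sqr t : phi m t <= (1 + t ^+ 2)^-1.
Proof.
rewrite /phi exprS ler_piMr ?(ltW (inv1sqr_gt0 t)) // exprn_ile1 ?(ltW (inv1sqr_gt0 t)) //.
by rewrite invf_le1 ?lerDl ?sqr_ge0 // ltr_pwDl ?sqr_ge0.
Qed.

(** Since 1 + |t| <= 2 (1 + t^2), each of m factors of the kernel absorbs one factor of growth, and
    a summable one is left over. *)
Lemma phi_moment t : phi m t * (1 + `|t|) ^+ m <= 2 ^+ m * (1 + t ^+ 2)^-1.
Proof.
rewrite /phi exprS mulrAC [X in _ <= X]mulrC -mulrA ler_wpM2l ?(ltW (inv1sqr_gt0 t)) //.
rewrite -exprMn lerXn2r ?nnegrE ?mulr_ge0 ?addr_ge0 ?(ltW (inv1sqr_gt0 t)) //.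
rewrite ler_pdivrMr ?ltr_pwDl ?sqr_ge0 // -[t ^+ 2]real_normK ?num_real //.
by have := sqr_ge0 (`|t| - 1); nra.
Qed.

Lemma phi_ge t : `|t| <= 1 -> (2 ^+ m.+1)^-1 <= phi m t.
Proof.
move=> t1; rewrite /phi exprVn lef_pV2 ?posrE ?exprn_gt0 // ?ltr_pwDl ?sqr_ge0 //.
rewrite lerXn2r ?nnegrE ?addr_ge0 ?sqr_ge0 //.
by rewrite -[2]/(1 + 1) lerD2l -real_normK ?num_real // exprn_ile1.
Qed.

Lemma phi_even t : phi m (- t) = phi m t.
Proof. by rewrite /phi sqrrN. Qed.

Lemma phi_le_invsqr t : t != 0 -> phi m t <= (t ^+ 2)^-1.
Proof.
move=> t0; have t2 : 0 < t ^+ 2 by rewrite lt_def sqrf_eq0 t0 sqr_ge0.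
rewrite (le_trans (phi_le_inv1sqr t)) // lef_pV2 ?posrE ?lerDr // ltr_pwDl ?sqr_ge0 //.
Qed.

Lemma atan_step (a d : R) : 0 < d -> d <= 1 ->
  d * (1 + a ^+ 2)^-1 <= 3 * (atan (a + d) - atan a).
Proof.
move=> d0 d1.
have ad : a < a + d by rewrite ltrDl.
have [c cI ->] := @MVT R atan (fun x => (1 + x ^+ 2)^-1) a (a + d) ad
  (fun x _ => is_derive1_atan x) (continuous_subspaceT (@continuous_atan R)).
rewrite addrAC subrr add0r mulrA mulrC ler_wpM2r ?(ltW d0) // inv1sqr_le3 //.
move: cI; rewrite in_itv /= => /andP[ac cd].
by rewrite distrC gtr0_norm ?subr_gt0 // lerBlDl (le_trans (ltW cd)) // lerD2l.
Qed.

(** Comparison with the integral: each term is at most 3 D times an increment of atan, and the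
    increments telescope to less than pi, whatever n and x are. *)
Lemma sum_inv1sqr (n D : nat) x : (0 < D)%N ->
  \sum_(k < n) (1 + ((x - k%:R) / D%:R) ^+ 2)^-1 <= 3 * pi * D%:R.
Proof.
move=> D0; have D0' : (0 : R) < D%:R by rewrite ltr0n.
have d1 : D%:R^-1 <= 1 :> R by rewrite invf_le1 // ler1n.
have step k : (1 + ((x - k%:R) / D%:R) ^+ 2)^-1 <=
   3 * D%:R * (atan ((k.+1%:R - x) / D%:R) - atan ((k%:R - x) / D%:R)).
  have D1 : 0 < D%:R^-1 :> R by rewrite invr_gt0.
  have := atan_step ((k%:R - x) / D%:R) D1 d1.
  rewrite ler_pdivrMl // -[k.+1%:R]natr1.
  have -> : (k%:R - x) / D%:R + D%:R^-1 = (k%:R + 1 - x) / D%:R by field; rewrite gt_eqF.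
  have -> : ((k%:R - x) / D%:R) ^+ 2 = ((x - k%:R) / D%:R) ^+ 2 by rewrite -opprB mulNr sqrrN.
  by move=> /le_trans; apply; rewrite mulrA (mulrC D%:R).
rewrite (le_trans (ler_sum _ (fun (k : 'I_n) _ => step k))) // -mulr_sumr.
have -> : \sum_(k < n) (atan ((k.+1%:R - x) / D%:R) - atan ((k%:R - x) / D%:R)) =
   atan ((n%:R - x) / D%:R) - atan ((0%:R - x) / D%:R).
  by rewrite -(big_mkord xpredT (fun k => atan ((k.+1%:R - x) / D%:R) - atan ((k%:R - x) / D%:R)))
     (telescope_sumr (fun k => atan ((k%:R - x) / D%:R))).
rewrite -mulrA (mulrC pi) mulrA ler_wpM2l ?mulr_ge0 //.
have h1 := atan_ltpi2 ((n%:R - x) / D%:R); have h2 := atan_gtNpi2 ((0%:R - x) / D%:R).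
lra.
Qed.

Definition mass (D L : nat) : R := \sum_(i < (2 * L).+1) phi m ((i%:R - L%:R) / D%:R).

(** The D indices from L to L + D - 1 suffice: there the argument of [phi] is in [0, 1]. *)
Lemma mass_ge (D L : nat) : (0 < D)%N -> (D <= L)%N -> D%:R / 2 ^+ m.+1 <= mass D L.
Proof.
move=> D0 DL; rewrite /mass -(big_mkord xpredT (fun i => phi m ((i%:R - L%:R) / D%:R))).
have LD : (L + D <= (2 * L).+1)%N by lia.
rewrite (big_cat_nat (n := L)) /=; [|lia|lia].
rewrite (big_cat_nat (m := L) (n := L + D)) /=; [|lia|lia].
have pos a b : 0 <= \sum_(a <= i < b) phi m ((i%:R - L%:R) / D%:R : R).
  by apply: sumr_ge0 => i _; exact/ltW/phi_gt0.
apply: (@le_trans _ _ (\sum_(L <= i < L + D) phi m ((i%:R - L%:R) / D%:R))); last first.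
  by rewrite addrCA lerDl addr_ge0.
have -> : D%:R / 2 ^+ m.+1 = \sum_(L <= i < L + D) (2 ^+ m.+1)^-1 :> R.
  by rewrite big_const_nat iter_addr_0 addKn mulr_natl.
rewrite big_nat [X in _ <= X]big_nat; apply: ler_sum => i /andP[Li iD].
apply: phi_ge; rewrite -natrB // normrM normfV !normr_nat ler_pdivrMr ?ltr0n // mul1r.
by rewrite ler_nat; lia.
Qed.

End kernel.

(** * Discrete smoothing *)

Section differences.
Context {R : realType}.
Implicit Types (f h : R -> R[i]^o) (t x d : R).

Lemma iter_fdiffE m t f x : iter m (fdiff t) f x =
  \sum_(0 <= i < m.+1) ((-1) ^+ (m - i) * 'C(m, i)%:R) * f (x + i%:R * t).
Proof.
suff e j : iter m (fdiff t) f (x + j%:R * t) = iter m fdseq (fun i => f (x + i%:R * t)) j.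
  by have := e 0%N; rewrite mul0r addr0 => ->; rewrite iter_fdseqE.
elim: m j => [//|m IH] j; rewrite !iterS /fdseq /fdiff -!IH; congr (_ - _).
by rewrite -addrA -natr1 mulrDl mul1r.
Qed.

(** The seminorm looks at positive steps only, whereas the averages run over both signs. *)
Lemma iter_fdiffN m t f x :
  iter m (fdiff t) f x = (-1) ^+ m * iter m (fdiff (- t)) f (x + m%:R * t) :> R[i].
Proof.
elim: m x => [|m IH] x; first by rewrite /= mul1r mul0r addr0.
rewrite !iterS /fdiff !IH -natr1 mulrDl mul1r.
have -> : x + t + m%:R * t = x + (m%:R * t + t) by rewrite -addrA (addrC t).
have -> : x + (m%:R * t + t) - t = x + m%:R * t by rewrite addrA addrK.
by rewrite exprS mulN1r mulNr -mulrN opprB mulrBr.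
Qed.

Variables (m : nat) (omega : R -> R) (f : R -> R[i]^o) (B : R).
Hypothesis m_gt0 : (0 < m)%N.
Hypothesis omega_gt0 : forall x : R, 0 < x -> 0 < omega x.
Hypothesis omega_ndecr : forall x y : R, 0 < x -> x <= y -> omega x <= omega y.
Hypothesis omega_doubling : forall x : R, 0 < x -> omega (2 * x) <= 2 ^+ m * omega x.
Hypothesis B0 : 0 <= B.
Hypothesis f_le : forall t x, 0 < t -> nrm (iter m (fdiff t) f x) <= B * omega t.

Lemma iter_fdiff_le t x : t != 0 -> nrm (iter m (fdiff t) f x) <= B * omega `|t|.
Proof.
move=> t0; have [t1|t1|] := ltgtP t 0; last by move/eqP; rewrite (negPf t0).
  by rewrite iter_fdiffN nrmM nrmX nrmN nrm1 expr1n mul1r ltr0_norm // f_le // oppr_gt0.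
by rewrite gtr0_norm // f_le.
Qed.

(** Each doubling contributes 2^m, which turns (t / 2)^m into t^m; the leading 2^m is therefore paid
    once, in the range 1 <= t <= 2. *)
Lemma omega_growth_ge1 t s : 0 < s -> 1 <= t -> omega (t * s) <= 2 ^+ m * t ^+ m * omega s.
Proof.
move=> s0; have base u : 1 <= u -> u <= 2 -> omega (u * s) <= 2 ^+ m * u ^+ m * omega s.
  move=> u1 u2; apply: (@le_trans _ _ (omega (2 * s))).
    by apply: omega_ndecr; rewrite ?mulr_gt0 ?ler_wpM2r ?(ltW s0) // (lt_le_trans ltr01).
  rewrite (le_trans (omega_doubling s0)) // ler_wpM2r ?(ltW (omega_gt0 s0)) //.
  by rewrite ler_peMr ?exprn_ge0 // exprn_ege1.
have [n tn] : exists n, t <= 2 ^+ n.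
  exists (Num.truncn t).+1; rewrite (le_trans (ltW (truncnS_gt t))) //.
  by rewrite -natrX ler_nat ltnW // ltn_expl.
elim: n t tn => [|n IH] t tn t1; first by apply: base => //; rewrite (le_trans tn) // expr0 ler1n.
have [t2|t2] := leP t 2; first exact: base.
have h1 : 1 <= t / 2 by rewrite ler_pdivlMr // mul1r ltW.
have h2 : t / 2 <= 2 ^+ n by rewrite ler_pdivrMr // -exprSr.
have -> : t * s = 2 * (t / 2 * s) by field.
have ts : 0 < t / 2 * s by rewrite mulr_gt0 // (lt_le_trans ltr01).
rewrite (le_trans (omega_doubling ts)) //.
rewrite (le_trans (ler_wpM2l (exprn_ge0 m (ler0n _ 2)) (IH _ h2 h1))) //.
rewrite !mulrA ler_wpM2r ?(ltW (omega_gt0 s0)) // -!mulrA ler_wpM2l ?exprn_ge0 //.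
by rewrite -exprMn mulrC divfK // pnatr_eq0.
Qed.

Lemma omega_growth t s : 0 < s -> 0 < t ->
  omega (t * s) <= 2 ^+ m * (1 + t) ^+ m * omega s.
Proof.
move=> s0 t0; have [t1|t1] := leP 1 t.
  rewrite (le_trans (omega_growth_ge1 s0 t1)) // ler_wpM2r ?(ltW (omega_gt0 s0)) //.
  rewrite ler_wpM2l ?exprn_ge0 // lerXn2r ?nnegrE ?addr_ge0 ?(ltW t0) //.
  by rewrite lerDr.
apply: (@le_trans _ _ (omega s)).
  by apply: omega_ndecr; rewrite ?mulr_gt0 // ler_piMl ?ltW.
rewrite ler_peMl ?(ltW (omega_gt0 s0)) // mulr_ege1 ?exprn_ege1 ?ler1n //.
by rewrite lerDl ltW.
Qed.

(* [smooth D h] is the average of [h - (-1)^m Delta_(l d)^m h] over the integers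
   [l = i - L], with weights proportional to [phi (l / D)] *)
Variables (L : nat) (d : R).
Hypothesis d0 : 0 < d.

Definition weight D (i : nat) : R := phi m ((i%:R - L%:R) / D%:R) / mass m D L.

(** The term j = 0 of (-1)^m Delta^m h cancels h. The others, with j = p.1 + 1, have the sign -
    (-1)^m (-1)^(m-j) = (-1)^(j-1). *)
Definition scoef D (p : 'I_m * 'I_(2 * L).+1) : R[i] :=
  (-1) ^+ p.1 * 'C(m, p.1.+1)%:R * (weight D p.2)%:C.

Definition sshift (p : 'I_m * 'I_(2 * L).+1) : R :=
  p.1.+1%:R * ((p.2%:R - L%:R) * d).

Definition smooth D h : R -> R[i]^o := fun x => \sum_p scoef D p * h (x + sshift p).

(** Both operators are finite combinations of translations. The telescoping over scales depends on
    this. *)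
Lemma smooth_comm D D' h : smooth D (smooth D' h) = smooth D' (smooth D h).
Proof.
apply/funext => x; rewrite /smooth.
under eq_bigr do rewrite mulr_sumr.
rewrite exchange_big; apply: eq_bigr => q _; rewrite mulr_sumr; apply: eq_bigr => p _.
by rewrite mulrCA addrAC.
Qed.

Lemma smoothB D h h' x : smooth D (fun x => h x - h' x) x = smooth D h x - smooth D h' x.
Proof. by rewrite /smooth -sumrB; apply: eq_bigr => p _; rewrite mulrBr. Qed.

Lemma mass_gt0 D : 0 < mass m D L :> R.
Proof.
rewrite /mass big_ord_recl ltr_pwDl ?phi_gt0 // sumr_ge0 // => i _; exact/ltW/phi_gt0.
Qed.

Lemma weight_ge0 D i : 0 <= weight D i.
Proof. by rewrite divr_ge0 // ltW ?phi_gt0 ?mass_gt0. Qed.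

Lemma sum_weight D : \sum_(i < (2 * L).+1) weight D i = 1.
Proof. by rewrite -mulr_suml divff // gt_eqF // mass_gt0. Qed.

Lemma sub_smoothE D x : f x - smooth D f x = \sum_(i < (2 * L).+1)
  (weight D i)%:C * ((-1) ^+ m * iter m (fdiff ((i%:R - L%:R) * d)) f x).
Proof.
have -> : f x = \sum_(i < (2 * L).+1) (weight D i)%:C * f x.
  by rewrite -mulr_suml -rmorph_sum sum_weight mul1r.
rewrite /smooth -(pair_big xpredT xpredT (fun j i => scoef D (j, i) * f (x + sshift (j, i)))) /=.
rewrite exchange_big -sumrB; apply: eq_bigr => i _.
rewrite iter_fdiffE big_mkord big_ord_recl /= subn0 bin0 mulr1 mul0r addr0.
rewrite mulrDr mulrA -expr2 sqrr_sign mul1r mulrDr; congr (_ + _).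
rewrite !mulr_sumr -sumrN; apply: eq_bigr => j _; rewrite /scoef /sshift /= /bump /= add1n.
have -> : (-1) ^+ m * ((-1) ^+ (m - j.+1) * 'C(m, j.+1)%:R * f (x + j.+1%:R * ((i%:R - L%:R) * d)))
   = - ((-1) ^+ j * 'C(m, j.+1)%:R * f (x + j.+1%:R * ((i%:R - L%:R) * d))) :> R[i].
  rewrite !mulrA -exprD -!mulNr; congr (_ * _ * _).
  have -> : (m + (m - j.+1) = j.+1 + 2 * (m - j.+1))%N by have := ltn_ord j; lia.
  by rewrite exprD exprM sqrrN !expr1n mulr1 exprS mulN1r.
by rewrite mulrN; congr (- _); rewrite mulrA [RHS]mulrA; congr (_ * _); rewrite mulrC.
Qed.

(** The factors come, in order, from [omega_growth], [phi_moment], [sum_inv1sqr] and [mass_ge]. *)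
Definition smooth_const : R := 2 ^+ m * 2 ^+ m * (3 * pi) * 2 ^+ m.+1.

Lemma sub_smooth_le D x : (0 < D)%N -> (D <= L)%N ->
  nrm (f x - smooth D f x) <= smooth_const * B * omega (D%:R * d).
Proof.
move=> D0 DL; have D0' : (0 : R) < D%:R by rewrite ltr0n.
have Dd : 0 < D%:R * d by exact: mulr_gt0.
have w0 := omega_gt0 Dd.
rewrite sub_smoothE (le_trans (nrm_sum _ _ _)) //.
have term (i : 'I_(2 * L).+1) : nrm ((weight D i)%:C * ((-1) ^+ m * iter m (fdiff ((i%:R - L%:R) * d)) f x))
   <= (2 ^+ m * 2 ^+ m * B * omega (D%:R * d) / mass m D L) * (1 + ((L%:R - i%:R) / D%:R) ^+ 2)^-1.
  rewrite nrmM nrmR ger0_norm ?weight_ge0 // nrmM nrmX nrmN nrm1 expr1n mul1r.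
  have rhs0 : 0 <= (2 ^+ m * 2 ^+ m * B * omega (D%:R * d) / mass m D L) * (1 + ((L%:R - i%:R) / D%:R) ^+ 2)^-1.
    by rewrite mulr_ge0 ?(ltW (inv1sqr_gt0 _)) // divr_ge0 ?(ltW (mass_gt0 _)) // !mulr_ge0 ?exprn_ge0 ?(ltW w0).
  (* The central index has step 0, outside the range of [iter_fdiff_le]; its difference vanishes
     because m > 0. *)
  have [l0|l0] := eqVneq (i%:R - L%:R : R) 0.
    have -> : iter m (fdiff ((i%:R - L%:R) * d)) f x = 0.
      rewrite l0 mul0r; case: (m) m_gt0 => // m' _.
      by rewrite iterS /fdiff addr0 subrr.
    by rewrite nrm0 mulr0.
  have h := @iter_fdiff_le ((i%:R - L%:R) * d) x.
  rewrite mulf_neq0 ?(gt_eqF d0) // in h; have {}h := h isT.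
  rewrite (le_trans (ler_wpM2l (weight_ge0 D i) h)) //.
  pose l : R := (i%:R - L%:R) / D%:R.
  have lE : `|(i%:R - L%:R) * d| = `|l| * (D%:R * d).
    rewrite normrM (gtr0_norm d0) /l normrM normfV (gtr0_norm D0') mulrA.
    by rewrite divfK // gt_eqF.
  have l1 : 0 < `|l| by rewrite normr_gt0 mulf_neq0 // invr_neq0 // gt_eqF.
  rewrite lE.
  have g := omega_growth Dd l1.
  rewrite (le_trans (ler_wpM2l (weight_ge0 D i) (ler_wpM2l B0 g))) //.
  have ph := phi_moment m l.
  have -> : (L%:R - i%:R) / D%:R = - l by rewrite /l -mulNr opprB.
  rewrite sqrrN /weight -/l.
  have -> : phi m l / mass m D L * (B * (2 ^+ m * (1 + `|l|) ^+ m * omega (D%:R * d))) =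
    (2 ^+ m * B * omega (D%:R * d) / mass m D L) * (phi m l * (1 + `|l|) ^+ m) by ring.
  have c0 : 0 <= 2 ^+ m * B * omega (D%:R * d) / mass m D L.
    by rewrite divr_ge0 ?(ltW (mass_gt0 _)) // !mulr_ge0 ?exprn_ge0 ?(ltW w0).
  apply: (le_trans (ler_wpM2l c0 ph)); rewrite le_eqVlt; apply/orP; left.
  by apply/eqP; ring.
rewrite (le_trans (ler_sum _ (fun i _ => term i))) // -mulr_sumr.
have S := sum_inv1sqr (2 * L).+1 (L%:R : R) D0.
have c0 : 0 <= 2 ^+ m * 2 ^+ m * B * omega (D%:R * d) / mass m D L.
  by rewrite divr_ge0 ?(ltW (mass_gt0 _)) // !mulr_ge0 ?exprn_ge0 ?(ltW w0).
rewrite (le_trans (ler_wpM2l c0 S)) //.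
have Z := @mass_ge R m D L D0 DL; rewrite ler_pdivrMr ?exprn_gt0 // in Z.
have Z0 := mass_gt0 D.
rewrite mulrAC ler_pdivrMr // /smooth_const.
have -> : 2 ^+ m * 2 ^+ m * (3 * pi) * 2 ^+ m.+1 * B * omega (D%:R * d) * mass m D L =
  (2 ^+ m * 2 ^+ m * B * omega (D%:R * d) * (3 * pi)) * (mass m D L * 2 ^+ m.+1) by ring.
by rewrite (mulrA _ (3 * pi) D%:R) ler_wpM2l // !mulr_ge0 ?exprn_ge0 ?(ltW w0) ?pi_ge0.
Qed.

End differences.

(** * Smooth models *)

(** A window of 2 L + 1 consecutive indices starting at r, inside 2 (L + P) + 1 indices, leaves out
    2 P of them. *)
Lemma window_arith (r P L : nat) : (r <= 2 * P)%N ->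
  [/\ (r <= (2 * (L + P)).+1)%N, (r + (2 * L).+1 <= (2 * (L + P)).+1)%N &
    (r + ((2 * (L + P)).+1 - (r + (2 * L).+1)) = 2 * P)%N].
Proof. by move=> rP; split; lia. Qed.

Lemma window_below (k r L : nat) : (k < r)%N -> (k <= L + r)%N /\ (L <= L + r - k)%N.
Proof. by move=> kr; split; lia. Qed.

Lemma window_above (k r L : nat) : (r + (2 * L).+1 <= k)%N ->
  (L + r <= k)%N /\ (L <= k - (L + r))%N.
Proof. by move=> kr; split; lia. Qed.

Section pieces.
Context {R : realType} {H : hilbertType R}.
Variables (A K : {linear H -> H}).
Hypotheses (bA : bounded_op A) (sA : selfadjoint A).
Hypotheses (bK : bounded_op K) (sK : selfadjoint K).
Variable m : nat.
Implicit Types (g F h : R -> R[i]^o).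

Lemma iter_fdseqD n (F G : nat -> H) j :
  iter n fdseq (fun i => F i + G i) j = iter n fdseq F j + iter n fdseq G j.
Proof. by elim: n j => [//|n IH] j; rewrite !iterS /fdseq !IH opprD addrACA. Qed.

Lemma iter_fdseqZ n (a : R[i]) (F : nat -> H) j :
  iter n fdseq (fun i => a *: F i) j = a *: iter n fdseq F j.
Proof. by elim: n j => [//|n IH] j; rewrite !iterS /fdseq !IH scalerBr. Qed.

Definition opdiff_bounded g (be : R) := exists2 B : nat -> {linear H -> H},
  forall j, cfc_approx (oshift A K j) g (B j) &
  op_le (fun u => iter m fdseq (fun j => B j u) 0%N) be.

Lemma opdiff_boundedD g g' be be' : opdiff_bounded g be -> opdiff_bounded g' be' ->
  opdiff_bounded (fun x => g x + g' x) (be + be').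
Proof.
move=> [B h1 h2] [B' h1' h2']; exists (fun j => B j \+ B' j) => [j|u /=].
  exact: cfc_approxD.
by rewrite iter_fdseqD (le_trans (nrmD _ _)) // mulrDl lerD.
Qed.

Lemma opdiff_boundedZ (a : R[i]) g be : opdiff_bounded g be -> opdiff_bounded (fun x => a * g x) (nrm a * be).
Proof.
move=> [B h1 h2]; exists (fun j => a \*: B j) => [j|u /=].
  exact: cfc_approxZ.
by rewrite iter_fdseqZ nrmZ -mulrA ler_wpM2l ?nrm_ge0 //; exact: h2.
Qed.

Lemma opdiff_bounded0 : opdiff_bounded (fun=> 0) 0.
Proof.
exists (fun=> \0) => [j|u /=]; first exact: cfc_approx0.
suff -> : forall j, iter m fdseq (fun=> 0 : H) j = 0 by rewrite nrm0 mul0r.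
by elim: m => [//|n IH] j; rewrite iterS /fdseq !IH subrr.
Qed.

Lemma opdiff_bounded_sum (I : Type) (r : seq I) (g : I -> R -> R[i]^o) (be : I -> R) :
  (forall i, opdiff_bounded (g i) (be i)) ->
  opdiff_bounded (fun x => \sum_(i <- r) g i x) (\sum_(i <- r) be i).
Proof.
move=> hg; elim: r => [|i r IH].
  by rewrite big_nil; under eq_fun do rewrite big_nil; exact: opdiff_bounded0.
by rewrite big_cons; under eq_fun do rewrite big_cons; exact: opdiff_boundedD.
Qed.

Lemma opdiff_bounded_le g be be' : be <= be' -> opdiff_bounded g be -> opdiff_bounded g be'.
Proof.
move=> le [B h1 h2]; exists B => // u; rewrite (le_trans (h2 u)) //.
by rewrite ler_wpM2r ?nrm_ge0.
Qed.

Variables (d : R) (A0 L : nat).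
Hypothesis d0 : 0 < d.

(* the lattice is spaced by [m! d] so that its points are also multiples of
   [j d] for every [j <= m] *)
Definition node (a : nat) : R := (m`!)%:R * d * (a%:R - A0%:R).

(** F is read at nodes only, because there the discrete average matches its model up to a tail; g is
    read on the whole cell around the node. *)
Definition tracks F g (er : R) := forall a x, (a <= 2 * A0)%N ->
  `|x - node a| <= (m`!)%:R * d -> nrm (F (node a) - g x) <= er.

Lemma tracksD F F' g g' er er' : tracks F g er -> tracks F' g' er' ->
  tracks (fun x => F x + F' x) (fun x => g x + g' x) (er + er').
Proof.
move=> h h' a x aA xa; rewrite opprD addrACA (le_trans (nrmD _ _)) // lerD //.
  exact: h.
exact: h'.
Qed.

Lemma tracksZ (c : R[i]) F g er : tracks F g er ->
  tracks (fun x => c * F x) (fun x => c * g x) (nrm c * er).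
Proof. by move=> h a x aA xa; rewrite -mulrBr nrmM ler_wpM2l ?nrm_ge0 //; exact: h. Qed.

Variables (h : R -> R[i]^o) (b : R) (D : nat).
Hypotheses (b0 : 0 <= b) (hb : forall x, nrm (h x) <= b).
Hypotheses (mD : (m`! <= D)%N) (DL : (D <= L)%N).

Let D0 : (0 < D)%N. Proof. exact: leq_trans (fact_gt0 m) mD. Qed.
Let D0' : (0 : R) < D%:R. Proof. by rewrite ltr0n. Qed.
Let Z0 : 0 < mass m D L :> R. Proof. exact: mass_gt0. Qed.
Let kap := fine (opnorm K).

Lemma mass_inv_le : (mass m D L)^-1 * D%:R <= 2 ^+ m.+1 :> R.
Proof.
have := @mass_ge R m D L D0 DL; rewrite ler_pdivrMr ?exprn_gt0 // => Z.
by rewrite ler_pdivrMl // (le_trans Z).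
Qed.

Lemma mass_inv_le1 : (mass m D L)^-1 <= 2 ^+ m.+1 :> R.
Proof.
by rewrite (le_trans _ mass_inv_le) // ler_peMr ?invr_ge0 ?(ltW Z0) // ler1n.
Qed.

Section one_step.
Variable J : nat.
Hypotheses (J0 : (0 < J)%N) (Jm : (J <= m)%N).

Let J0' : (0 : R) < J%:R. Proof. by rewrite ltr0n. Qed.

Definition avg (x : R) : R[i] :=
  \sum_(i < (2 * L).+1) (weight m L D i)%:C * h (x + J%:R * ((i%:R - L%:R) * d)).

(** In units of [J d] the nodes are integers of size at most P. Windows reach L further, so 2 M + 1
    sample points centred at 0 contain them all. *)
Let P := ((m`! %/ J) * A0)%N.
Let M := (L + P)%N.
Let s := J%:R * D%:R * d.
Let y (k : nat) : R := J%:R * d * (k%:R - M%:R).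
Let hh (k : nat) : R[i] := ((mass m D L)^-1)%:C * h (y k).

(** In [avg] the sample points move with x and the weights are fixed; here the points are fixed and
    the kernel moves, which is the form that [phi_sum_cfc] treats. *)
Definition avg_model : R -> R[i]^o :=
  phi_sum m s (fun k : 'I_(2 * M).+1 => y k) (fun k => hh k).

Let s0 : 0 < s. Proof. by rewrite !mulr_gt0. Qed.

Let hhb k : nrm (hh k) <= b / mass m D L.
Proof. by rewrite nrmM nrmR gtr0_norm ?invr_gt0 // mulrC ler_wpM2r ?invr_ge0 ?(ltW Z0). Qed.

Let bZ0 : 0 <= b / mass m D L. Proof. by rewrite divr_ge0 // ltW. Qed.

Let xyE x k : (x - y k) / s = (x / (J%:R * d) + M%:R - k%:R) / D%:R.
Proof. by rewrite /y /s; field; rewrite !gt_eqF. Qed.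

Let sumC x : \sum_(k < (2 * M).+1) (1 + ((x - y k) / s) ^+ 2)^-1 <= 3 * pi * D%:R.
Proof. by under eq_bigr do rewrite xyE; exact: sum_inv1sqr. Qed.

(** The resolvent sums are of order D and the mass is at least of order D, so only the width
    matters; J >= 1 can only increase it. *)
Lemma avg_model_nice : opdiff_bounded avg_model
  ((size (dwords m (base_word m)))%:R * b * (3 * pi * 2 ^+ m.+1) * (kap / (D%:R * d)) ^+ m).
Proof.
have kap0 : 0 <= kap by exact: fine_opnorm_ge0.
have [B h1 h2] := @phi_sum_cfc R H A K bA sA bK sK m (2 * M).+1 s (fun k => y k)
  (fun k => hh k) _ _ s0 bZ0 (fun k => hhb k) sumC.
exists B => // u; rewrite (le_trans (h2 u)) // ler_wpM2r ?nrm_ge0 //.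
apply: ler_pM.
- by rewrite !mulr_ge0 ?invr_ge0 ?(ltW Z0) ?pi_ge0.
- by rewrite exprn_ge0 // divr_ge0 // ltW.
- rewrite -!mulrA ler_wpM2l // ler_wpM2l //.
  have -> : (mass m D L)^-1 * (3 * (pi * D%:R)) = 3 * (pi * ((mass m D L)^-1 * D%:R)) :> R by ring.
  by rewrite !ler_wpM2l ?pi_ge0 // mass_inv_le.
- rewrite lerXn2r ?nnegrE ?divr_ge0 ?(ltW s0) ?mulr_ge0 ?(ltW d0) //.
  rewrite ler_wpM2l // lef_pV2 ?posrE ?mulr_gt0 // /s -mulrA ler_peMl ?mulr_ge0 ?(ltW d0) //.
  by rewrite ler1n.
Qed.

Lemma avg_model_lip x x' : `|x - x'| <= (m`!)%:R * d ->
  nrm (avg_model x' - avg_model x) <= b * (3 ^+ m.+1 * (m`!)%:R / D%:R * (3 * pi) * 2 ^+ m.+1).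
Proof.
move=> xx; rewrite /avg_model /phi_sum -sumrB (le_trans (nrm_sum _ _ _)) //.
have eta k : `|(x' - y k) / s - (x - y k) / s| <= (m`!)%:R / D%:R.
  have -> : (x' - y k) / s - (x - y k) / s = - (x - x') / s by field; rewrite gt_eqF.
  rewrite mulNr normrN normrM normfV (gtr0_norm s0) ler_pdivrMr // (le_trans xx) //.
  have -> : (m`!)%:R / D%:R * s = J%:R * ((m`!)%:R * d) by rewrite /s; field; rewrite gt_eqF.
  by rewrite ler_peMl ?ler1n // mulr_ge0 // ltW.
have eta1 : (m`!)%:R / D%:R <= 1 :> R by rewrite ler_pdivrMr // mul1r ler_nat.
have term (k : 'I_(2 * M).+1) : nrm (hh k * (phi m ((x' - y k) / s))%:C - hh k * (phi m ((x - y k) / s))%:C)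
   <= (b / mass m D L) * (3 ^+ m.+1 * ((m`!)%:R / D%:R)) * (1 + ((x - y k) / s) ^+ 2)^-1.
  rewrite -mulrBr -rmorphB nrmM nrmR -mulrA ler_pM ?nrm_ge0 //.
  rewrite (le_trans (phi_lip m (le_trans (eta k) eta1))) //.
  rewrite ler_pM ?mulr_ge0 ?(ltW (phi_gt0 _ _)) ?phi_le_inv1sqr // ler_wpM2l //.
rewrite (le_trans (ler_sum _ (fun k _ => term k))) // -mulr_sumr.
have c0 : 0 <= b / mass m D L * (3 ^+ m.+1 * ((m`!)%:R / D%:R)).
  by rewrite mulr_ge0 // mulr_ge0 // divr_ge0.
rewrite (le_trans (ler_wpM2l c0 (sumC x))) //.
have -> : b / mass m D L * (3 ^+ m.+1 * ((m`!)%:R / D%:R)) * (3 * pi * D%:R) =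
  b * (3 ^+ m.+1 * (m`!)%:R / D%:R * (3 * pi)) * ((mass m D L)^-1 * D%:R) by ring.
rewrite (le_trans (ler_wpM2l _ mass_inv_le)) //.
  by rewrite !mulr_ge0 ?invr_ge0 ?pi_ge0.
by rewrite -!mulrA.
Qed.

(** At a node the moving window is a block of the fixed sample points, so the two sums differ by the
    points outside it. There are at most 2 m! A0 of these, each at distance at least L / D in units
    of the kernel width, where [phi] is at most (D / L)^2. *)
Lemma avg_model_node a : (a <= 2 * A0)%N -> nrm (avg (node a) - avg_model (node a)) <=
  b * ((2 * m`! * A0)%:R * 2 ^+ m.+1 * (D%:R / L%:R) ^+ 2).
Proof.
move=> aA; set r := ((m`! %/ J) * a)%N.
have Jd : (J %| m`!)%N by rewrite dvdn_fact // J0.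
have rP : (r <= 2 * P)%N by rewrite /r /P mulnCA leq_mul2l aA orbT.
have L0 : (0 : R) < L%:R by rewrite ltr0n (leq_trans D0).
pose q : R := r%:R - P%:R.
have nodeE : node a = J%:R * d * q.
  rewrite /node /q /r /P !natrM -mulrBr !mulrA; congr (_ * _).
  by rewrite mulrAC -natrM mulnC divnK // mulrC.
pose F (k : nat) : R[i] := hh k * (phi m ((node a - y k) / s))%:C.
have argE k : (node a - y k) / s = - ((k%:R - M%:R - q) / D%:R).
  by rewrite xyE nodeE; field; rewrite !gt_eqF.
have avgE : avg (node a) = \sum_(r <= k < r + (2 * L).+1) F k.
  rewrite -{1}[r]add0n big_addn addKn big_mkord; apply: eq_bigr => i _.
  have e : (i + r)%:R - M%:R - q = i%:R - L%:R :> R.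
    by rewrite /M /q !natrD; ring.
  rewrite /F argE e phi_even /weight /hh.
  have -> : y (i + r) = node a + J%:R * ((i%:R - L%:R) * d).
    by rewrite -e nodeE /y; ring.
  have aux (u v w : R[i]) : u * v * w = v * w * u by ring.
  by apply: etrans (aux _ _ _); congr (_ * _); exact: rmorphM.
have modE : avg_model (node a) = \sum_(0 <= k < (2 * M).+1) F k.
  by rewrite big_mkord.
have [le1 le2 le3] := window_arith L rP; rewrite -/M in le1 le2 le3.
have tail k : (k < r)%N || (r + (2 * L).+1 <= k)%N -> nrm (F k) <= b * (2 ^+ m.+1 * (D%:R / L%:R) ^+ 2).
  move=> kr; rewrite /F nrmM nrmR (gtr0_norm (phi_gt0 _ _)) argE phi_even.
  set t : R := _ / D%:R.
  have lt : L%:R / D%:R <= `|t|.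
    rewrite normrM normfV (gtr0_norm D0') ler_wpM2r ?invr_ge0 ?(ltW D0') //.
    have -> : k%:R - M%:R - q = k%:R - (L + r)%:R :> R by rewrite /M /q !natrD; ring.
    case/orP: kr => kr.
      have [k1 k2] := window_below L kr.
      by rewrite distrC -natrB // normr_nat ler_nat.
    by have [k1 k2] := window_above kr; rewrite -natrB // normr_nat ler_nat.
  have LD : 0 < L%:R / D%:R :> R by rewrite divr_gt0.
  have t0 : t != 0 by rewrite -normr_gt0 (lt_le_trans LD).
  have ph : phi m t <= (D%:R / L%:R) ^+ 2.
    rewrite (le_trans (phi_le_invsqr m t0)) // -[t ^+ 2]real_normK ?num_real //.
    rewrite -exprVn lerXn2r ?nnegrE ?invr_ge0 ?divr_ge0 //.
    by rewrite -(invf_div L%:R D%:R) lef_pV2 ?posrE ?normr_gt0.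
  rewrite mulrA ler_pM ?nrm_ge0 ?(ltW (phi_gt0 _ _)) // (le_trans (hhb k)) //.
  by rewrite ler_wpM2l // mass_inv_le1.
have -> : avg (node a) - avg_model (node a) =
    - (\sum_(0 <= k < r) F k + \sum_(r + (2 * L).+1 <= k < (2 * M).+1) F k).
  rewrite avgE modE (big_cat_nat (n := r) (p := (2 * M).+1)) //=.
  rewrite (big_cat_nat (m := r) (n := r + (2 * L).+1) (p := (2 * M).+1)) //=; last by rewrite leq_addr.
  by ring.
rewrite nrmN (le_trans (nrmD _ _)) //.
set T := b * _ in tail.
have T0 : 0 <= T by rewrite !mulr_ge0 ?exprn_ge0 ?divr_ge0.
have s1 : nrm (\sum_(0 <= k < r) F k) <= r%:R * T.
  rewrite (le_trans (nrm_sum _ _ _)) // mulr_natl -[X in T *+ X]subn0 -iter_addr_0 -big_const_nat.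
  by apply: ler_sum_nat => k /andP[_ kr]; rewrite tail // kr.
have s2 : nrm (\sum_(r + (2 * L).+1 <= k < (2 * M).+1) F k) <= ((2 * M).+1 - (r + (2 * L).+1))%:R * T.
  rewrite (le_trans (nrm_sum _ _ _)) // mulr_natl -iter_addr_0 -big_const_nat.
  by apply: ler_sum_nat => k /andP[kr _]; rewrite tail // kr orbT.
rewrite (le_trans (lerD s1 s2)) // -mulrDl -natrD.
rewrite le3.
have -> : b * ((2 * m`! * A0)%:R * 2 ^+ m.+1 * (D%:R / L%:R) ^+ 2) = (2 * m`! * A0)%:R * T.
  by rewrite /T; ring.
rewrite ler_wpM2r // ler_nat /P -mulnA leq_mul2l /= leq_mul2r.
by rewrite leq_div orbT.
Qed.

End one_step.

(** 2^m bounds the binomial coefficients of [smooth], the size counts the words of an m-th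
    difference, and the rest is lattice sum against mass. *)
Definition model_const : R := 2 ^+ m * (size (dwords m (base_word m)))%:R * (3 * pi * 2 ^+ m.+1).

(** The first term is the cut-off at L, small for L large with D and A0 fixed; the second is the
    rounding of x to a node, small for D large. *)
Definition piece_err : R := 2 ^+ m *
  ((2 * m`! * A0)%:R * 2 ^+ m.+1 * (D%:R / L%:R) ^+ 2 +
   3 ^+ m.+1 * (m`!)%:R / D%:R * (3 * pi) * 2 ^+ m.+1).

Lemma sum_bin_le : \sum_(j < m) nrm ((-1) ^+ j * 'C(m, j.+1)%:R : R[i]) <= 2 ^+ m.
Proof.
have -> : 2 ^+ m = \sum_(j < m.+1) 'C(m, j)%:R :> R.
  have := @exprDn R 1 1 m; rewrite -[1 + 1]/2 => ->.
  by apply: eq_bigr => i _; rewrite !expr1n mulr1.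
rewrite big_ord_recl bin0 /= addrC (le_trans _ (_ : \sum_(j < m) 'C(m, j.+1)%:R <= _)) //.
  by apply: ler_sum => j _; rewrite nrmM nrmX nrmN nrm1 expr1n mul1r nrm_nat.
by rewrite /bump /= lerDl.
Qed.

Lemma piece : exists2 g, opdiff_bounded g (model_const * b * (kap / (D%:R * d)) ^+ m) &
  tracks (smooth m L d D h) g (b * piece_err).
Proof.
pose c (j : 'I_m) : R[i] := (-1) ^+ j * 'C(m, j.+1)%:R.
pose be := (size (dwords m (base_word m)))%:R * b * (3 * pi * 2 ^+ m.+1) * (kap / (D%:R * d)) ^+ m.
pose er := b * ((2 * m`! * A0)%:R * 2 ^+ m.+1 * (D%:R / L%:R) ^+ 2 +
   3 ^+ m.+1 * (m`!)%:R / D%:R * (3 * pi) * 2 ^+ m.+1).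
have kap0 : 0 <= kap by exact: fine_opnorm_ge0.
have be0 : 0 <= be.
  by rewrite !mulr_ge0 ?exprn_ge0 ?divr_ge0 ?mulr_ge0 ?pi_ge0 ?(ltW d0).
have er0 : 0 <= er.
  by rewrite mulr_ge0 // addr_ge0 // !mulr_ge0 ?exprn_ge0 ?divr_ge0 ?invr_ge0 ?pi_ge0.
exists (fun x => \sum_j c j * avg_model j.+1 x).
  apply: (opdiff_bounded_le _ (opdiff_bounded_sum _ (fun j : 'I_m => opdiff_boundedZ (c j) (avg_model_nice (ltn0Sn j))))).
  rewrite -mulr_suml -/be (le_trans (ler_wpM2r be0 sum_bin_le)) //.
  by rewrite le_eqVlt; apply/orP; left; apply/eqP; rewrite /be /model_const; ring.
have sE : smooth m L d D h = fun x => \sum_j c j * avg j.+1 x.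
  apply/funext => x; rewrite /smooth -(pair_big xpredT xpredT
    (fun (j : 'I_m) (i : 'I_(2 * L).+1) => scoef D (j, i) * h (x + sshift d (j, i)))) /=.
  apply: eq_bigr => j _; rewrite /avg mulr_sumr; apply: eq_bigr => i _.
  exact/esym/mulrA.
rewrite sE => a x aA xa; rewrite -sumrB (le_trans (nrm_sum _ _ _)) //.
have -> : b * piece_err = 2 ^+ m * er by rewrite /piece_err /er; ring.
rewrite (le_trans _ (ler_wpM2r er0 sum_bin_le)) // mulr_suml; apply: ler_sum => j _.
rewrite -mulrBr nrmM ler_wpM2l ?nrm_ge0 //.
rewrite -(subrK (avg_model j.+1 (node a)) (avg j.+1 (node a))) -addrA (le_trans (nrmD _ _)) //.
rewrite /er mulrDr lerD //; first exact: avg_model_node.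
exact: avg_model_lip.
Qed.

End pieces.

(** * Decomposition of f over dyadic scales *)

Section decomposition.
Context {R : realType} {H : hilbertType R}.
Variables (A K : {linear H -> H}).
Hypotheses (bA : bounded_op A) (sA : selfadjoint A).
Hypotheses (bK : bounded_op K) (sK : selfadjoint K).
Variables (m : nat) (omega : R -> R) (f : R -> R[i]^o) (B Mf : R).
Hypothesis m_gt0 : (0 < m)%N.
Hypothesis omega_gt0 : forall x : R, 0 < x -> 0 < omega x.
Hypothesis omega_ndecr : forall x y : R, 0 < x -> x <= y -> omega x <= omega y.
Hypothesis omega_doubling : forall x : R, 0 < x -> omega (2 * x) <= 2 ^+ m * omega x.
Hypothesis B0 : 0 <= B.
Hypothesis f_le : forall t x, 0 < t -> nrm (iter m (fdiff t) f x) <= B * omega t.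
Hypothesis f_bnd : forall x, nrm (f x) <= Mf.
Hypothesis f_cont : continuous f.
Hypothesis kap_gt0 : 0 < fine (opnorm K).

Let kap := fine (opnorm K).
Let Mf0 : 0 <= Mf. Proof. exact: le_trans (nrm_ge0 _) (f_bnd 0). Qed.
Let smooth_const_ge0 : 0 <= smooth_const m :> R.
Proof. by rewrite !mulr_ge0 ?exprn_ge0 ?pi_ge0. Qed.
Let model_const_ge0 : 0 <= model_const m :> R.
Proof. by rewrite !mulr_ge0 ?exprn_ge0 ?pi_ge0. Qed.

Definition gain (n : nat) : R := smooth_const m * B * omega (2 ^+ n * kap).

Lemma gain_ge0 n : 0 <= gain n.
Proof.
apply: mulr_ge0; first exact: mulr_ge0.
by apply/ltW/omega_gt0; rewrite mulr_gt0 // exprn_gt0.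
Qed.

Definition nice_bound (N : nat) : R := \sum_(n < N)
  (model_const m * gain n.+1 * (2 ^+ n)^-1 ^+ m + model_const m * gain n * (2 ^+ n.+1)^-1 ^+ m).

Definition gain_sum (N : nat) : R := \sum_(n < N) (gain n.+1 + gain n).

Section fixed_lattice.
Variables (D0 A0 L N : nat).
Hypotheses (mD0 : (m`! <= D0)%N) (DNL : (2 ^ N * D0 <= L)%N).

Let D0_gt0 : (0 < D0)%N. Proof. exact: leq_trans (fact_gt0 m) mD0. Qed.
Let D0R : (0 : R) < D0%:R. Proof. by rewrite ltr0n. Qed.
(** With this mesh, [2 ^ n * D0] steps make up exactly the width 2^n ||K||. *)
Let d := kap / D0%:R.
Let d0 : 0 < d. Proof. by rewrite divr_gt0. Qed.

Definition err : R := 2 ^+ m *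
  ((2 * m`! * A0)%:R * 2 ^+ m.+1 * ((2 ^ N * D0)%:R / L%:R) ^+ 2 +
   3 ^+ m.+1 * (m`!)%:R / D0%:R * (3 * pi) * 2 ^+ m.+1).

Let T n := smooth m L d (2 ^ n * D0)%N.

Let Dd n : (2 ^ n * D0)%:R * d = 2 ^+ n * kap.
Proof. by rewrite natrM natrX /d; field; rewrite gt_eqF. Qed.

Let kD n : kap / ((2 ^ n * D0)%:R * d) = (2 ^+ n)^-1.
Proof. by rewrite Dd invfM mulrCA divff ?mulr1 // gt_eqF. Qed.

Let Dge n : (D0 <= 2 ^ n * D0)%N. Proof. by rewrite leq_pmull // expn_gt0. Qed.

Let DL n : (n <= N)%N -> (2 ^ n * D0 <= L)%N.
Proof. by move=> nN; rewrite (leq_trans _ DNL) // leq_mul2r leq_exp2l // nN orbT. Qed.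

Let E_le n x : (n <= N)%N -> nrm (f x - T n f x) <= gain n.
Proof.
move=> nN; rewrite /gain -Dd; apply: sub_smooth_le => //; last exact: DL.
exact: leq_trans (Dge n).
Qed.

Let piece_err_le n : (n <= N)%N -> piece_err m A0 L (2 ^ n * D0)%N <= err.
Proof.
move=> nN; have L0 : (0 : R) < L%:R.
  by rewrite ltr0n (leq_trans D0_gt0) // (leq_trans (Dge N)).
rewrite /piece_err /err ler_wpM2l ?exprn_ge0 // lerD //.
  rewrite ler_wpM2l ?mulr_ge0 ?exprn_ge0 // lerXn2r ?nnegrE ?divr_ge0 //.
  by rewrite ler_wpM2r ?invr_ge0 // ler_nat leq_mul2r leq_exp2l // nN orbT.
rewrite !ler_wpM2r ?exprn_ge0 ?mulr_ge0 ?pi_ge0 //.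
rewrite ler_wpM2l ?mulr_ge0 ?exprn_ge0 // lef_pV2 ?posrE ?ltr0n ?ler_nat //.
exact: leq_trans (Dge n).
Qed.

Let tracks_le F g (e e' : R) : e <= e' -> tracks m d A0 F g e -> tracks m d A0 F g e'.
Proof. by move=> ee h a x aA xa; rewrite (le_trans _ ee) //; exact: h. Qed.

Let one n h b : (n <= N)%N -> 0 <= b -> (forall x, nrm (h x) <= b) ->
  exists2 g, opdiff_bounded A K m g (model_const m * b * (2 ^+ n)^-1 ^+ m) & tracks m d A0 (T n h) g (b * err).
Proof.
move=> nN b0 hb; have [g g1 g2] := piece bA sA bK sK A0 d0 b0 hb
  (leq_trans mD0 (Dge n)) (DL nN).
exists g; first by rewrite -(kD n).
by apply: tracks_le g2; rewrite ler_wpM2l // piece_err_le.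
Qed.

(* T_n - T_(n+1) = T_n (1 - T_(n+1)) - T_(n+1) (1 - T_n) *)
Let telescope n : (n <= N)%N -> exists2 g, opdiff_bounded A K m g (nice_bound n) &
  tracks m d A0 (fun x => T 0 f x - T n f x) g (gain_sum n * err).
Proof.
elim: n => [_|n IH nN].
  exists (fun=> 0); first by rewrite /nice_bound big_ord0; exact: opdiff_bounded0.
  by move=> a x _ _; rewrite !subrr nrm0 /gain_sum big_ord0 mul0r.
have [g g1 g2] := IH (ltnW nN).
have [p p1 p2] := one (ltnW nN) (gain_ge0 n.+1) (fun x => E_le x nN).
have [q q1 q2] := one nN (gain_ge0 n) (fun x => E_le x (ltnW nN)).
exists (fun x => g x + (p x + -1 * q x)).
  have := opdiff_boundedD g1 (opdiff_boundedD p1 (opdiff_boundedZ (-1) q1)); rewrite nrmN nrm1 mul1r.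
  by rewrite /nice_bound big_ord_recr.
have := tracksD g2 (tracksD p2 (tracksZ (-1) q2)); rewrite nrmN nrm1 mul1r.
rewrite -!mulrDl /gain_sum big_ord_recr /= => tr a x aA xa.
have := tr a x aA xa; congr (nrm (_ - _) <= _).
rewrite /T !smoothB (smooth_comm _ _ _ (2 ^ n.+1 * D0)).
by ring.
Qed.

(** f - T_0 f gets no smooth model: its size [gain 0] is put into the tracking error. *)
Lemma lattice_approx : exists2 g, opdiff_bounded A K m g (nice_bound N + model_const m * Mf * (2 ^+ N)^-1 ^+ m) &
  tracks m d A0 f g (gain 0 + (gain_sum N + Mf) * err).
Proof.
have [g g1 g2] := telescope (leqnn N).
have [p p1 p2] := one (leqnn N) Mf0 f_bnd.
exists (fun x => g x + p x); first exact: opdiff_boundedD.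
have := tracksD g2 p2; rewrite -mulrDl => tr a x aA xa.
have h1 := tr a x aA xa; have h2 := E_le (node m d A0 a) (leq0n N).
rewrite -(subrK (T 0 f (node m d A0 a)) (f (node m d A0 a))) -addrA.
rewrite (le_trans (nrmD _ _)) // lerD //; move: h1; congr (nrm (_ - _) <= _).
by rewrite subrK.
Qed.

End fixed_lattice.

Lemma nat_above (x : R) : exists n : nat, x <= n%:R.
Proof. by exists (Num.truncn x).+1; exact/ltW/truncnS_gt. Qed.

(** The order of choices matters: D0 makes the mesh and the rounding error small, A0 then makes the
    nodes cover [-r, r], and L comes last, since the cut-off error grows with A0 and with 2^N D0. *)
Lemma good_approx (N : nat) (r e : R) : 0 <= r -> 0 < e ->
  exists2 g, opdiff_bounded A K m g (nice_bound N + model_const m * Mf * (2 ^+ N)^-1 ^+ m) &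
  forall x, `|x| <= r -> nrm (f x - g x) <= gain 0 + e.
Proof.
move=> r0 e0; have e20 : 0 < e / 2 by exact: divr_gt0.
have [dl dl0 hdl] := segment_uniform_continuous r f_cont e20.
pose W := gain_sum N + Mf + 1.
have W0 : 0 < W.
  by rewrite ltr_wpDl // addr_ge0 // sumr_ge0 // => n _; rewrite addr_ge0 ?gain_ge0.
pose e' := e / 2 / W; have e'0 : 0 < e' by exact: divr_gt0.
(* The error [err] is al (DN / L)^2 + ga / D0; ga is free of D0, so D0 can be chosen against it. *)
pose ga : R := 2 ^+ m * (3 ^+ m.+1 * (m`!)%:R * (3 * pi) * 2 ^+ m.+1).
have ga0 : 0 <= ga by rewrite !mulr_ge0 ?exprn_ge0 ?pi_ge0.
have [n1 hn1] := nat_above (2 * ga / e').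
have [n2 hn2] := nat_above ((m`!)%:R * kap / dl).
pose D0 := (m`! + n1 + n2.+1)%N.
have mD0 : (m`! <= D0)%N by rewrite /D0 -addnA leq_addr.
have D0R : (0 : R) < D0%:R by rewrite ltr0n (leq_trans (fact_gt0 m)).
pose d := kap / D0%:R; have d0 : 0 < d by exact: divr_gt0.
have md0 : 0 < (m`!)%:R * d by rewrite mulr_gt0 // ltr0n fact_gt0.
have [A0 hA0] := nat_above (r / ((m`!)%:R * d)).
rewrite ler_pdivrMr // in hA0.
pose al : R := 2 ^+ m * ((2 * m`! * A0)%:R * 2 ^+ m.+1).
have al0 : 0 <= al by rewrite !mulr_ge0 ?exprn_ge0.
pose DN := (2 ^ N * D0)%N.
have DN0 : (0 : R) < DN%:R by rewrite ltr0n muln_gt0 expn_gt0 (leq_trans (fact_gt0 m) mD0).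
have [n3 hn3] := nat_above (2 * al * DN%:R / e').
pose L := (DN + n3)%N.
have DNL : (DN <= L)%N by exact: leq_addr.
have L0 : (0 : R) < L%:R by rewrite (lt_le_trans DN0) // ler_nat.
have errle : err D0 A0 L N <= e'.
  have -> : err D0 A0 L N = al * (DN%:R / L%:R) ^+ 2 + ga / D0%:R.
    by rewrite /err /al /ga /DN; ring.
  rewrite [e']splitr lerD //; last first.
    rewrite ler_pdivrMr // -ler_pdivrMl ?divr_gt0 // invf_div mulrC mulrA.
    rewrite (mulrC ga) (le_trans hn1) // ler_nat /D0.
    exact: leq_trans (leq_addl _ _) (leq_addr _ _).
  have q1 : DN%:R / L%:R <= 1 :> R by rewrite ler_pdivrMr // mul1r ler_nat.
  have q0 : 0 <= DN%:R / L%:R :> R by rewrite divr_ge0 // ltW.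
  apply: (@le_trans _ _ (al * (DN%:R / L%:R))).
    by rewrite ler_wpM2l // expr2 ler_piMr.
  rewrite mulrA ler_pdivrMr // -ler_pdivrMl ?divr_gt0 // invf_div.
  rewrite (_ : 2 / e' * (al * DN%:R) = 2 * al * DN%:R / e'); last by ring.
  by rewrite (le_trans hn3) // ler_nat leq_addl.
have [g g1 g2] := @lattice_approx D0 A0 L N mD0 DNL.
exists g => // x xr.
have mdl : (m`!)%:R * d < dl.
  rewrite /d mulrA ltr_pdivrMr // -ltr_pdivrMl // mulrC (le_lt_trans hn2) //.
  by rewrite ltr_nat /D0 addnS ltnS leq_addl.
(* The position of x in mesh units, counted from the leftmost node; its integer part is the index of
   the node to the left of x. *)
pose t := (x + (m`!)%:R * d * A0%:R) / ((m`!)%:R * d).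
move: (xr); rewrite ler_norml => /andP[x1 x2].
have t0 : 0 <= t by rewrite divr_ge0 ?(ltW md0) //; lra.
have t2 : t <= 2 * A0%:R by rewrite ler_pdivrMr //; lra.
pose a := Num.truncn t.
have /andP[a1 a2] := truncn_itv t0; rewrite -/a in a1 a2.
have aA : (a <= 2 * A0)%N by rewrite -(ler_nat R) natrM (le_trans a1).
have xE : x - node m d A0 a = (m`!)%:R * d * (t - a%:R).
  have tE : (m`!)%:R * d * t = x + (m`!)%:R * d * A0%:R.
    by rewrite /t mulrC divfK // gt_eqF.
  by rewrite [RHS]mulrBr tE /node; ring.
have xa : `|x - node m d A0 a| <= (m`!)%:R * d.
  rewrite xE normrM (gtr0_norm md0) ler_piMr ?(ltW md0) //.
  by rewrite ger0_norm ?subr_ge0 // lerBlDr addrC natr1 ltW.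
have h1 := g2 a x aA xa.
have h2 := hdl x (node m d A0 a) xr (le_lt_trans xa mdl).
have h3 : (gain_sum N + Mf) * err D0 A0 L N <= e / 2.
  have gs0 : 0 <= gain_sum N + Mf.
    by rewrite addr_ge0 // sumr_ge0 // => n _; rewrite addr_ge0 ?gain_ge0.
  rewrite (le_trans (ler_wpM2l gs0 errle)) // /e' mulrCA ler_piMr ?(ltW e20) //.
  by rewrite ler_pdivrMr // mul1r /W lerDl.
rewrite -(subrK (f (node m d A0 a)) (f x)) -addrA (le_trans (nrmD _ _)) //.
lra.
Qed.

End decomposition.

(** * The seminorm and the dyadic sum *)

Section zygmund_facts.
Context {R : realType}.
Implicit Types (g f : R -> R[i]^o).

Lemma fdiff_continuous (t : R) g : continuous g -> continuous (fdiff t g).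
Proof.
move=> /continuous_nrm cg; apply/continuous_nrm => x e e0.
have e2 : 0 < e / 2 by exact: divr_gt0.
have [d1 d10 h1] := cg x _ e2; have [d2 d20 h2] := cg (x + t) _ e2.
exists (Num.min d1 d2); first by rewrite lt_min d10.
move=> y; rewrite lt_min => /andP[xy1 xy2]; rewrite /fdiff.
have -> : g (x + t) - g x - (g (y + t) - g y) =
   (g (x + t) - g (y + t)) - (g x - g y) :> R[i] by ring.
rewrite (le_lt_trans (nrmB _ _)) // [e]splitr ltrD ?h1 // h2 //.
by rewrite opprD addrACA subrr addr0.
Qed.

Lemma iter_fdiff_continuous n (t : R) g : continuous g -> continuous (iter n (fdiff t) g).
Proof. by move=> cg; elim: n => [//|n IH] /=; exact: fdiff_continuous. Qed.

(** If |g| exceeded M at a point, continuity would make it do so on a ball, which has positive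
    measure. *)
Lemma Linfty_normP g (M : R) : continuous g -> (Linfty_norm g <= M%:E)%E ->
  forall x, nrm (g x) <= M.
Proof.
move=> /continuous_nrm cg; rewrite /Linfty_norm unlock.
have -> : (0 < lebesgue_measure [set: R])%E.
  by rewrite -set_itvNyy lebesgue_measure_itv /= ltry.
move=> /ess_supP [N [mN N0 hN]] x; rewrite leNgt; apply/negP => gM.
have e0 : 0 < nrm (g x) - M by rewrite subr_gt0.
have [d d0 hd] := cg x _ e0.
have sub : ball x d `<=` N.
  move=> y xy; apply: hN; rewrite /= lee_fin => h.
  have h1 : nrm (g y) <= M by apply: le_trans h; exact: ler_norm.
  have := hd y xy; have := nrmD (g x - g y) (g y); rewrite subrK; lra.
have : (lebesgue_measure (ball x d) <= lebesgue_measure N)%E.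
  apply: le_measure; rewrite ?inE //; exact: measurable_ball.
rewrite N0 lebesgue_measure_ball ?(ltW d0) // lee_fin leNgt => /negP; apply.
by rewrite pmulrn_lgt0.
Qed.

Lemma Lambda_norm_ge0 (omega : R -> R) m f : (forall x : R, 0 < x -> 0 < omega x) ->
  (0 <= Lambda_norm omega m f)%E.
Proof.
move=> w0; apply: le_trans (_ : (_ <= Linfty_norm (iter m (fdiff 1) f) * ((omega 1)^-1)%:E)%E) _.
  rewrite mule_ge0 ?Lnorm_ge0 // lee_fin invr_ge0 ltW // w0 //.
by apply: ereal_sup_ubound; exists 1 => //=.
Qed.

Lemma Lambda_normP (omega : R -> R) m f : (forall x : R, 0 < x -> 0 < omega x) ->
  Lambda omega m f -> forall t x : R, 0 < t ->
  nrm (iter m (fdiff t) f x) <= fine (Lambda_norm omega m f) * omega t.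
Proof.
move=> w0 [cf fin] t x t0; apply: Linfty_normP; first exact: iter_fdiff_continuous.
have LE : Lambda_norm omega m f = (fine (Lambda_norm omega m f))%:E.
  by rewrite fineK // ge0_fin_numE // Lambda_norm_ge0.
have : (Linfty_norm (iter m (fdiff t) f) * ((omega t)^-1)%:E <= Lambda_norm omega m f)%E.
  by apply: ereal_sup_ubound; exists t.
by rewrite lee_pdivrMr ?w0 // LE.
Qed.

End zygmund_facts.

(** * The dyadic sum and the integral *)

Section omega_star_bound.
Context {R : realType}.
Variables (m : nat) (omega : R -> R).
Hypothesis omega_gt0 : forall x : R, 0 < x -> 0 < omega x.
Hypothesis omega_ndecr : forall x y : R, 0 < x -> x <= y -> omega x <= omega y.
Variable x : R.
Hypothesis x0 : 0 < x.

Let pt (n : nat) : R := 2 ^+ n * x.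

Let I (t : R) : R := omega t / t ^+ m.+1.

Let mI : measurable_fun (`[x, +oo[ : set R) I.
Proof.
(* [omega] is monotone on the positive half-line only; clamping the argument at x makes both factors
   monotone on the whole line. *)
apply: (eq_measurable_fun (fun t => omega (Num.max x t) * (Num.max x t)^-1 ^+ m.+1)).
  move=> t; rewrite inE /= in_itv /= andbT => xt.
  by rewrite max_r // exprVn.
apply: measurable_funM.
  apply: nondecreasing_measurable => // a b ab.
  apply: omega_ndecr; first by rewrite lt_max x0.
  by rewrite ge_max !le_max lexx ab orbT.
apply: nonincreasing_measurable => // a b ab.
have ma : 0 < Num.max x a by rewrite lt_max x0.
have mb : 0 < Num.max x b by rewrite lt_max x0.
rewrite lerXn2r ?nnegrE ?invr_ge0 ?(ltW ma) ?(ltW mb) // lef_pV2 ?posrE //.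
by rewrite ge_max !le_max lexx ab orbT.
Qed.

Definition dyadic_sum (N : nat) : R := \sum_(n < N) (2 ^+ n)^-1 ^+ m * omega (2 ^+ n * x).

(** On [2^n x, 2^(n+1) x) the integrand is at least omega (2^n x) / (2^(n+1) x)^(m+1); multiplying
    by the length 2^n x gives the n-th term over 2^(m+1) x^m. *)
Lemma dyadic_sum_le N :
  ((dyadic_sum N)%:E <= (2 ^+ m.+1)%:E * omega_star omega m x)%E.
Proof.
rewrite /omega_star gt_eqF //.
have pos n : 0 < pt n by rewrite mulr_gt0 // exprn_gt0.
have sub a b : x <= a -> [set` `[a, b[ ] `<=` [set` `[x, +oo[ ].
  move=> xa t /=; rewrite !in_itv /= andbT => /andP[at_ _]; exact: le_trans at_.
have xp n : x <= pt n by rewrite ler_peMl ?(ltW x0) // exprn_ege1 // ler1n.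
have I0 (t : R) : x <= t -> (0 <= (I t)%:E)%E.
  move=> xt; have t0 : 0 < t by exact: lt_le_trans xt.
  by rewrite lee_fin divr_ge0 ?exprn_ge0 ?(ltW t0) // ltW // omega_gt0.
have mIs a b : x <= a -> measurable_fun (`[a, b[ : set R) I.
  by move=> xa; apply: measurable_funS mI => //; exact: sub.
have step n : (((2 ^+ m.+1)^-1 * (x ^+ m)^-1 * ((2 ^+ n)^-1 ^+ m * omega (2 ^+ n * x)))%:E <=
    \int[lebesgue_measure]_(t in `[pt n, pt n.+1[) (I t)%:E)%E.
  set c := omega (pt n) / pt n.+1 ^+ m.+1.
  have lt : pt n < pt n.+1 by rewrite ltr_pM2r // ltr_eXn2l // ltr1n.
  apply: (@le_trans _ _ (\int[lebesgue_measure]_(t in `[pt n, pt n.+1[) (cst c%:E t))%E).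
    rewrite integral_cst //= lebesgue_measure_itv /= lte_fin lt -EFinB -EFinM lee_fin.
    rewrite le_eqVlt; apply/orP; left; apply/eqP; rewrite /c /pt (exprS 2 n).
    have p0 : 0 < 2 ^+ n :> R by rewrite exprn_gt0.
    set p := 2 ^+ n in p0 *; rewrite !exprMn !exprVn (exprS p) (exprS x) (exprS 2 m).
    by field; rewrite !expf_neq0 ?gt_eqF.
  apply: ge0_le_integral => //.
  - by move=> t _; rewrite lee_fin divr_ge0 ?exprn_ge0 ?ltW ?omega_gt0.
  - by apply/measurable_EFinP; exact: mIs (xp n).
  - move=> t; rewrite /= in_itv /= => /andP[t1 t2]; rewrite lee_fin /c /I.
    have t0 : 0 < t by exact: lt_le_trans t1.
    rewrite ler_pM ?(ltW (omega_gt0 _)) ?invr_ge0 ?exprn_ge0 ?(ltW (pos _)) //.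
      exact: omega_ndecr.
    by rewrite lef_pV2 ?posrE ?exprn_gt0 // lerXn2r ?nnegrE ?(ltW t0) ?(ltW (pos _)) // ltW.
have dy : (((2 ^+ m.+1)^-1 * (x ^+ m)^-1 * dyadic_sum N)%:E <=
    \int[lebesgue_measure]_(t in `[x, pt N[) (I t)%:E)%E.
  elim: N => [|N IH].
    rewrite /dyadic_sum big_ord0 mulr0 integral_ge0 // => t /=.
    by rewrite in_itv /= => /andP[xt _]; exact: I0.
  have -> : [set` `[x, pt N.+1[ ] = [set` `[x, pt N[ ] `|` [set` `[pt N, pt N.+1[ ].
    have lt : pt N <= pt N.+1 by rewrite ler_pM2r // ler_eXn2l // ltr1n.
    apply/seteqP; split => t /=; rewrite !in_itv /=.
      by move=> /andP[t1 t2]; case: (ltP t (pt N)) => t3; [left|right]; apply/andP.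
    case=> /andP[t1 t2]; apply/andP; split => //; first exact: lt_le_trans lt.
    exact: le_trans t1.
  rewrite ge0_integral_setU //=.
  - by rewrite /dyadic_sum big_ord_recr /= mulrDr EFinD leeD // step.
  - by apply/measurable_EFinP; apply: measurable_funS mI => // t [] /=;
      rewrite !in_itv /= andbT => /andP[t1 _] //; exact: le_trans t1.
  - move=> t [] /=; rewrite !in_itv /= => /andP[t1 _]; apply: I0 => //.
    exact: le_trans t1.
  - apply/disj_set2P; rewrite -subset0 => t [] /=; rewrite !in_itv /=.
    by move=> /andP[_ t1] /andP[t2 _]; move: (lt_le_trans t1 t2); rewrite ltxx.
have sub_int : (\int[lebesgue_measure]_(t in `[x, pt N[) (I t)%:E <=
    \int[lebesgue_measure]_(t in `[x, +oo[) (I t)%:E)%E.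
  apply: ge0_subset_integral => //.
  - exact/measurable_EFinP.
  - by move=> t /=; rewrite in_itv /= andbT; exact: I0.
  - exact: sub.
have := le_trans dy sub_int; rewrite -/(I _).
set J := (\int[_]_(t in _) _)%E => h.
rewrite muleA -EFinM.
have c0 : 0 < 2 ^+ m.+1 * x ^+ m by rewrite mulr_gt0 // exprn_gt0.
rewrite -lee_pdivrMl // -EFinM (le_trans _ h) // lee_fin.
by rewrite invfM.
Qed.

End omega_star_bound.

(** * Conclusion *)

Section operator_bound.
Context {R : realType} {H : hilbertType R}.
Variables (A K : {linear H -> H}).
Hypotheses (bA : bounded_op A) (sA : selfadjoint A).
Hypotheses (bK : bounded_op K) (sK : selfadjoint K).
Variables (m : nat) (omega : R -> R) (f : R -> R[i]^o) (B Mf : R).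
Hypothesis m_gt0 : (0 < m)%N.
Hypothesis omega_gt0 : forall x : R, 0 < x -> 0 < omega x.
Hypothesis omega_ndecr : forall x y : R, 0 < x -> x <= y -> omega x <= omega y.
Hypothesis omega_doubling : forall x : R, 0 < x -> omega (2 * x) <= 2 ^+ m * omega x.
Hypothesis B0 : 0 <= B.
Hypothesis f_le : forall t x, 0 < t -> nrm (iter m (fdiff t) f x) <= B * omega t.
Hypothesis f_bnd : forall x, nrm (f x) <= Mf.
Hypothesis f_cont : continuous f.

Let kap := fine (opnorm K).

Definition opdiff (v : H) : H := \sum_(0 <= j < m.+1)
  ((-1) ^+ (m - j) * 'C(m, j)%:R) *: cfc (oshift A K j) f v.

(** The interval contains the real spectra of all A + j K with j <= m, so f - g costs e for each j,
    and the binomial coefficients sum to 2^m. *)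
Lemma opdiff_le_approx g (be e : R) : opdiff_bounded A K m g be ->
  (forall x, `|x| <= fine (opnorm A) + m%:R * kap -> nrm (f x - g x) <= e) ->
  op_le opdiff (be + 2 ^+ m * e).
Proof.
move=> [G G1 G2] fg v.
have e0 : 0 <= e.
  apply: le_trans (nrm_ge0 _) (fg 0 _).
  by rewrite normr0 addr_ge0 ?mulr_ge0 ?fine_opnorm_ge0.
have dif j : (j <= m)%N -> nrm (cfc (oshift A K j) f v - G j v) <= e * nrm v.
  move=> jm; have bj := oshift_bounded j bA bK; have sj := oshift_selfadjoint j sA sK.
  have [Bj -> hB] := cfc_ex bj sj f_cont.
  have hd := cfc_approxD hB (cfc_approxZ (-1) (G1 j)).
  have := cfc_approx_le bj sj e0 hd.
  move=> /(_ _)/(_ v) /=; rewrite scaleN1r; apply => x sx.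
  rewrite mulN1r; apply: fg.
  rewrite (le_trans (spectrum_le bj sx)) //.
  have a0 : 0 <= fine (opnorm A) + j%:R * kap.
    by rewrite addr_ge0 ?mulr_ge0 ?fine_opnorm_ge0.
  apply: (@le_trans _ _ (fine (opnorm A) + j%:R * kap)).
    rewrite -lee_fin -bounded_op_fin_num //; apply/opnorm_le => //.
    exact: oshift_le.
  by rewrite lerD2l ler_wpM2r ?fine_opnorm_ge0 // ler_nat.
have -> : opdiff v = iter m fdseq (fun j => G j v) 0%N + \sum_(0 <= j < m.+1)
    ((-1) ^+ (m - j) * 'C(m, j)%:R) *: (cfc (oshift A K j) f v - G j v).
  rewrite iter_fdseqE -big_split /=; apply: eq_bigr => j _.
  by rewrite add0n -scalerDr addrCA subrr addr0.
rewrite (le_trans (nrmD _ _)) // mulrDl lerD //.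
have -> : 2 ^+ m * e * nrm v = \sum_(0 <= j < m.+1) 'C(m, j)%:R * (e * nrm v).
  rewrite -mulr_suml -mulrA; congr (_ * _); rewrite big_mkord.
  have := @exprDn R 1 1 m; rewrite -[1 + 1]/2 => ->.
  by apply: eq_bigr => i _; rewrite !expr1n mulr1.
rewrite (le_trans (nrm_sum _ _ _)) //; apply: ler_sum_nat => j /andP[_ jm].
by rewrite nrmZ nrmM nrmX nrmN nrm1 expr1n mul1r nrm_nat ler_wpM2l // dif.
Qed.

(** 2^m + 1 arises when [gain n.+1] is reduced to [gain n] by doubling; the last 2^m is the cost of
    the part f - T_0 f. *)
Definition bound_const : R := smooth_const m * (model_const m * (2 ^+ m + 1) + 2 ^+ m).

(** The index [N.+1] guarantees that the dyadic sum has its term n = 0, which dominates [gain 0]. *)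
Lemma opdiff_le N (e : R) : 0 < kap -> 0 < e -> op_le opdiff
  (bound_const * B * dyadic_sum m omega kap N.+1 + model_const m * Mf * (2 ^+ N.+1)^-1 ^+ m + 2 ^+ m * e).
Proof.
move=> kap0 e0; pose r := fine (opnorm A) + m%:R * kap.
have r0 : 0 <= r by rewrite addr_ge0 ?mulr_ge0 ?fine_opnorm_ge0.
have [g g1 g2] := good_approx bA sA bK sK m_gt0 omega_gt0 omega_ndecr omega_doubling
  B0 f_le f_bnd f_cont kap0 N.+1 r0 e0.
move=> v; apply: le_trans (opdiff_le_approx g1 g2 v) _; rewrite ler_wpM2r ?nrm_ge0 //.
have c1 : 0 <= smooth_const m :> R by rewrite !mulr_ge0 ?exprn_ge0 ?pi_ge0.
have c2 : 0 <= model_const m :> R by rewrite !mulr_ge0 ?exprn_ge0 ?pi_ge0.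
have c1B : 0 <= smooth_const m * B by exact: mulr_ge0.
have pos n : 0 < 2 ^+ n * kap by rewrite mulr_gt0 // exprn_gt0.
have g0 : gain K m omega B 0 <= smooth_const m * B * dyadic_sum m omega kap N.+1.
  rewrite /gain ler_wpM2l // /dyadic_sum big_ord_recl expr0 invr1 expr1n !mul1r lerDl.
  by rewrite sumr_ge0 // => n _; rewrite mulr_ge0 ?exprn_ge0 ?invr_ge0 ?exprn_ge0 ?(ltW (omega_gt0 _)).
have nb : nice_bound K m omega B N.+1 <= model_const m * (2 ^+ m + 1) * (smooth_const m * B * dyadic_sum m omega kap N.+1).
  rewrite /nice_bound /dyadic_sum !mulr_sumr; apply: ler_sum => n _.
  rewrite /gain -/kap.
  have w1 : omega (2 ^+ n.+1 * kap) <= 2 ^+ m * omega (2 ^+ n * kap).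
    by rewrite exprS -mulrA omega_doubling.
  have w0 : 0 <= omega (2 ^+ n * kap) by rewrite ltW // omega_gt0.
  have p0 : 0 <= (2 ^+ n)^-1 ^+ m :> R by rewrite exprn_ge0 // invr_ge0 exprn_ge0.
  have p1 : (2 ^+ n.+1)^-1 ^+ m <= (2 ^+ n)^-1 ^+ m :> R.
    rewrite lerXn2r ?nnegrE ?invr_ge0 ?exprn_ge0 // lef_pV2 ?posrE ?exprn_gt0 //.
    by rewrite ler_eXn2l // ltr1n.
  have -> : model_const m * (2 ^+ m + 1) * (smooth_const m * B * ((2 ^+ n)^-1 ^+ m * omega (2 ^+ n * kap))) =
    model_const m * (smooth_const m * B) * (2 ^+ m * omega (2 ^+ n * kap)) * (2 ^+ n)^-1 ^+ m +
    model_const m * (smooth_const m * B) * omega (2 ^+ n * kap) * (2 ^+ n)^-1 ^+ m by ring.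
  have cc : 0 <= model_const m * (smooth_const m * B) by exact: mulr_ge0.
  rewrite lerD // (mulrA (model_const m) (smooth_const m * B)).
    by rewrite ler_wpM2r // ler_wpM2l.
  by rewrite ler_wpM2l // mulr_ge0.
rewrite /bound_const; have m2 : 0 <= 2 ^+ m :> R by rewrite exprn_ge0.
move: g0 nb; set S := dyadic_sum _ _ _ _; set a := gain _ _ _ _ _; set b := nice_bound _ _ _ _ _.
set z := model_const m * Mf * _ => g0 nb.
have := ler_wpM2l m2 g0; lra.
Qed.

End operator_bound.

Local Close Scope complex_scope.

Theorem theorem11p1 (R : realType) (m : nat) (m_gt0 : (0 < m)%N) :
  exists c : R, 0 < c /\
    forall (omega : R -> R)
      (omega_gt0 : forall x : R, 0 < x -> 0 < omega x)
      (omega_ndecr : forall x y : R, 0 < x -> x <= y -> omega x <= omega y)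
      (omega_lim : omega x @[x --> 0^'+] --> 0)
      (omega_doubling : forall x : R, 0 < x -> omega (2 * x) <= 2 ^+ m * omega x)
      (f : R -> R[i]^o)
      (f_Lambda : Lambda omega m f)
      (f_bounded : exists M : R[i], forall x, `|f x| <= M)
      (H : hilbertType R) (A K : {linear H -> H})
      (A_bounded : bounded_op A) (A_selfadjoint : selfadjoint A)
      (K_bounded : bounded_op K) (K_selfadjoint : selfadjoint K),
    (opnorm (fun v : H => \sum_(0 <= j < m.+1)
        ((-1) ^+ (m - j) * 'C(m, j)%:R) *: cfc (A \+ j%:R \*: K) f v)%R
     <= c%:E * Lambda_norm omega m f * omega_star omega m (fine (opnorm K)))%E.
Proof.
have c2 : 0 <= model_const m :> R by rewrite !mulr_ge0 ?exprn_ge0 ?pi_ge0.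
have C0 : 0 <= bound_const m :> R.
  apply: mulr_ge0; first by rewrite !mulr_ge0 ?exprn_ge0 ?pi_ge0.
  by rewrite addr_ge0 ?exprn_ge0 // mulr_ge0 // addr_ge0 ?exprn_ge0.
(* 2^(m+1) is the loss in [dyadic_sum_le]; adding 1 makes c positive. *)
exists (bound_const m * 2 ^+ m.+1 + 1); split.
  by rewrite ltr_wpDl // mulr_ge0 // exprn_ge0.
move=> omega omega_gt0 omega_ndecr _ omega_doubling f f_Lambda [M f_M] H A K bA sA bK sK.
set c := bound_const m * _ + 1; have c0 : 0 < c by rewrite ltr_wpDl // mulr_ge0 // exprn_ge0.
set kap := fine (opnorm K).
have kap_ge0 : 0 <= kap by exact: fine_opnorm_ge0.
have L0 := @Lambda_norm_ge0 R omega m f omega_gt0.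
have f_le := Lambda_normP omega_gt0 f_Lambda.
have [f_cont Lfin] := f_Lambda.
set B := fine (Lambda_norm omega m f) in f_le.
have LE : Lambda_norm omega m f = B%:E by rewrite /B fineK // ge0_fin_numE.
have B0 : 0 <= B by rewrite -lee_fin -LE.
have f_bnd x : nrm (f x) <= complex.Re M.
  by have := f_M x; rewrite normE lecE /= => /andP[].
rewrite LE; apply: ub_ereal_sup => _ [v /= v1 <-].
have nv1 : nrm v <= 1 by rewrite -nrm_le.
rewrite -/(nrm _) -/(opdiff A K m f v).
(* Here [omega_star] takes its separate value 0. All the operators coincide with A, and the m-th
   difference of a constant sequence vanishes as m > 0. *)
have [k0|k0] := eqVneq kap 0.
  have K0 u : K u = 0.
    apply/eqP; rewrite -nrm_eq0 eq_le nrm_ge0 andbT.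
    by have := bounded_opP bK u; rewrite -/kap k0 mul0r.
  rewrite /omega_star k0 eqxx mule0.
  have oE j : oshift A K j = A :> (H -> H).
    by apply/funext => u; rewrite /= K0 scaler0 addr0.
  have -> : opdiff A K m f v = iter m fdseq (fun=> cfc A f v) 0%N.
    by rewrite iter_fdseqE /opdiff; apply: eq_bigr => j _; rewrite oE.
  case: (m) m_gt0 => // n _.
  suff -> : iter n.+1 fdseq (fun=> cfc A f v) 0%N = 0 by rewrite nrm0.
  have z k : iter k fdseq (fun=> 0 : H) = fun=> 0.
    by elim: k => [//|k IH]; rewrite iterS IH; apply/funext => i; rewrite /fdseq subrr.
  rewrite iterSr (_ : fdseq (fun=> cfc A f v) = fun=> 0) ?z //.
  by apply/funext => i; rewrite /fdseq subrr.
have kap0 : 0 < kap by rewrite lt_def k0.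
have M0 : 0 <= complex.Re M by exact: le_trans (nrm_ge0 _) (f_bnd 0).
have dyadic_sum_ge0 N : 0 <= dyadic_sum m omega kap N.
  apply: sumr_ge0 => n _; rewrite mulr_ge0 ?exprn_ge0 ?invr_ge0 ?exprn_ge0 //.
  by apply/ltW/omega_gt0; rewrite mulr_gt0 // exprn_gt0.
have main N e : 0 < e -> nrm (opdiff A K m f v) <= bound_const m * B * dyadic_sum m omega kap N.+1 +
    model_const m * complex.Re M * (2 ^+ N.+1)^-1 ^+ m + 2 ^+ m * e.
  move=> e0; have h := opdiff_le bA sA bK sK m_gt0 omega_gt0 omega_ndecr omega_doubling
    B0 f_le f_bnd f_cont N kap0 e0 v.
  apply: le_trans h _; rewrite ler_piMr // addr_ge0 ?mulr_ge0 ?(ltW e0) ?exprn_ge0 //.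
  apply: addr_ge0; first by apply: mulr_ge0 (dyadic_sum_ge0 _); exact: mulr_ge0.
  by apply: mulr_ge0; [exact: mulr_ge0|rewrite exprn_ge0 // invr_ge0 exprn_ge0].
(* The passage to the limit: e / 2 pays for the uniform approximation, the other half for the term
   with sup |f|, by 2^(N+1) >= N and m >= 1. *)
have small W : 0 <= W -> (forall N, bound_const m * B * dyadic_sum m omega kap N.+1 <= W) ->
    nrm (opdiff A K m f v) <= W.
  move=> W0 hW; apply/ler_addgt0Pr => e e0.
  have e20 : 0 < e / 2 by exact: divr_gt0.
  have m2 : 0 < 2 ^+ m :> R by exact: exprn_gt0.
  have [N hN] := nat_above (model_const m * complex.Re M / (e / 2)).
  rewrite ler_pdivrMr // in hN.
  apply: le_trans (main N _ (divr_gt0 e20 m2)) _.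
  rewrite [in X in _ <= X](splitr e) addrA lerD ?lerD ?hW //; last first.
    by rewrite mulrCA divff ?mulr1 // gt_eqF.
  have p0 : 0 < 2 ^+ N.+1 :> R by exact: exprn_gt0.
  have p1 : (2 ^+ N.+1)^-1 <= 1 :> R by rewrite invf_le1 // exprn_ege1 // ler1n.
  have cM : 0 <= model_const m * complex.Re M by exact: mulr_ge0.
  apply: (@le_trans _ _ (model_const m * complex.Re M * (2 ^+ N.+1)^-1)).
    rewrite ler_wpM2l // -(prednK m_gt0) exprS ler_piMr ?invr_ge0 ?(ltW p0) //.
    by rewrite exprn_ile1 // invr_ge0 ltW.
  rewrite ler_pdivrMr // [X in _ <= X]mulrC (le_trans hN) // ler_wpM2r ?(ltW e20) //.
  by rewrite -natrX ler_nat ltnW // (ltn_trans (ltnSn N)) // ltn_expl.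
(* [omega_star] may be infinite, and then 0 times infinity is 0 on the right; the left side has to
   vanish too, and does so by [small]. *)
have [B00|B00] := eqVneq B 0.
  rewrite B00 mule0 mul0e lee_fin small // => N.
  by rewrite B00 mulr0 mul0r.
have Bgt0 : 0 < B by rewrite lt_def B00.
have W0 : (0 <= omega_star omega m kap)%E.
  have := dyadic_sum_le m omega_gt0 omega_ndecr kap0 0%N.
  by rewrite /dyadic_sum big_ord0 pmule_rge0 // lte_fin exprn_gt0.
have [Winf|Wfin] := eqVneq (omega_star omega m kap) +oo%E.
  by rewrite Winf -EFinM gt0_muley ?lte_fin ?mulr_gt0 // leey.
have WE : omega_star omega m kap = (fine (omega_star omega m kap))%:E.
  by rewrite fineK // ge0_fin_numE // ltey.
rewrite WE -!EFinM lee_fin; set W := fine _ in WE *.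
have W00 : 0 <= W by rewrite fine_ge0.
have dW N : dyadic_sum m omega kap N.+1 <= 2 ^+ m.+1 * W.
  have := dyadic_sum_le m omega_gt0 omega_ndecr kap0 N.+1.
  by rewrite WE -EFinM lee_fin.
apply: small => [|N]; first by rewrite !mulr_ge0 // ltW.
have CB : 0 <= bound_const m * B by exact: mulr_ge0.
rewrite (le_trans (ler_wpM2l CB (dW N))) //.
have -> : bound_const m * B * (2 ^+ m.+1 * W) = bound_const m * 2 ^+ m.+1 * B * W by ring.
by rewrite !ler_wpM2r // /c lerDl.
Qed.
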